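(* The dendroidal nerve $N_d(\mathcal P)$ of any operad $\mathcal P$ is a strict inner Kan complex.
   Context: Operad means symmetric coloured operad in sets. Trees are finite rooted trees with a root (output) edge and a set of leaves (input edges); vertices may have any number $\ge 0$ of inputs. $\eta$ is the tree with one edge and no vertices. An edge is inner if it has a vertex at both ends; otherwise it is outer. Each tree $T$ defines an operad $\Omega(T)$ whose colours are the edges of $T$ and which is freely generated by the vertices of $T$; thus $\Omega(T)(e_1,\dots,e_n;e_0)$ is a singleton if there is a subtree of $T$ with root $e_0$ and leaves exactly the pairwise distinct edges $e_1,\dots,e_n$, and is empty otherwise. The category $\Omega$ has trees as objects and operad maps $\Omega(T)\to\Omega(T')$ as arrows. A dendroidal set is a functor $X:\Omega^{op}\to Set$, with $X_T=X(T)$; $\Omega[T]$ is the representable one. Faces of $T$: for an inner edge $e$, the inner face $\partial_e:T/e\to T$ obtained by contracting $e$; for a vertex $v$ with exactly one inner edge attached, the outer face $\partial_v:T/v\to T$ obtained by deleting $v$ and all outer edges attached to it; if $T$ has exactly one vertex, each edge of $T$ gives an outer face $\eta\to T$. For an inner edge $e$, the inner horn $\Lambda^e[T]\subseteq\Omega[T]$ is the union of all faces except $\partial_e$. A dendroidal set $K$ is a strict inner Kan complex if for every tree $T$ and inner edge $e$ of $T$ the map $Hom(\Omega[T],K)\to Hom(\Lambda^e[T],K)$ is bijective. The dendroidal nerve of an operad $\mathcal P$ is the dendroidal set $N_d(\mathcal P)_T=Hom(\Omega(T),\mathcal P)$ (maps of operads). *)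

(* Defs.v *)
From HB Require Import structures.
From mathcomp Require Import all_boot all_order.
From Stdlib Require Import ProofIrrelevance.

Set Implicit Arguments.
Unset Strict Implicit.
Unset Printing Implicit Defensive.

(* A sequence c_1, ..., c_n is a function on 'I_n.  The position of the j-th
    entry of the i-th block in a concatenation is [tagnat.Rank i j]; the blocks
    follow each other in lexicographic order ([tagnat.RankEsum]). *)

Definition concat (A : Type) n (k : 'I_n -> nat) (b : forall i, 'I_(k i) -> A) :
    'I_(\sum_i k i)%N -> A :=
  fun x => b (tagnat.sig1 x) (tagnat.sig2 x).

Lemma concat_Rank (A : Type) n (k : 'I_n -> nat)
    (b : forall i, 'I_(k i) -> A) i j : concat b (tagnat.Rank i j) = b i j.
Proof.
rewrite /concat /tagnat.Rank.
suff -> : forall x, b (tagnat.sig1 x) (tagnat.sig2 x)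
          = (fun p : {i & 'I_(k i)} => b (tag p) (tagged p)) (tagnat.sig x).
  by rewrite tagnat.rankK.
by [].
Qed.

(* The bijection sending the j-th entry of block i to the (g i j)-th entry of
   block s i: a block permutation if g is the identity, a direct sum of
   permutations if s is the identity. *)
Definition block_map m n (s : 'I_m -> 'I_n) (k : 'I_m -> nat) (l : 'I_n -> nat)
    (g : forall i, 'I_(k i) -> 'I_(l (s i))) :
    'I_(\sum_i k i)%N -> 'I_(\sum_i l i)%N :=
  concat (fun i j => tagnat.Rank (s i) (g i j)).

Lemma Rank_inj2 n (k : 'I_n -> nat) i j i' j' :
  @tagnat.Rank n k i j = tagnat.Rank i' j' ->
  Tagged (fun i => 'I_(k i)) j = Tagged (fun i => 'I_(k i)) j'.
Proof. exact: tagnat.rank_inj. Qed.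

Lemma id_bij (T : Type) : bijective (fun x : T => x).
Proof. by exists id. Qed.

Lemma bij_inj_card (S T : finType) (f : S -> T) :
  injective f -> (forall y, exists x, f x = y) -> bijective f.
Proof.
move=> fi fs; apply: inj_card_bij => //.
have <- : #|codom f| = #|T|.
  by apply: eq_card => y; rewrite [RHS]inE; have [x <-] := fs y; rewrite codom_f.
exact: leq_image_card.
Qed.

Lemma block_map_bij m n (s : 'I_m -> 'I_n) (k : 'I_m -> nat) (l : 'I_n -> nat)
    (g : forall i, 'I_(k i) -> 'I_(l (s i))) :
  bijective s -> (forall i, bijective (g i)) -> bijective (block_map g).
Proof.
move=> sb gb; apply: bij_inj_card => [x y|y].
  rewrite /block_map /concat => /Rank_inj2 E.
  apply: tagnat.sig_inj; rewrite !tagnat.sigE12.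
  move: (tagnat.sig1 x) (tagnat.sig2 x) (tagnat.sig1 y) (tagnat.sig2 y) E.
  move=> i j i' j' E.
  have /(bij_inj sb) ii' := congr1 tag E; case: _ / ii' in j' E *.
  by have /(bij_inj (gb i)) -> := eq_from_Tagged E.
suff surj i j : exists x, block_map g x = tagnat.Rank i j.
  by rewrite -[y]tagnat.sig2K.
have [t st ts] := sb; move: j; rewrite -(ts i) => j.
have [h gh hg] := gb (t i).
exists (tagnat.Rank (t i) (h j)).
by apply: etrans (concat_Rank _ _) _; rewrite hg.
Qed.

Lemma block_map_concat (A : Type) m n (s : 'I_m -> 'I_n) (k : 'I_m -> nat)
    (l : 'I_n -> nat) (g : forall i, 'I_(k i) -> 'I_(l (s i)))
    (b : forall i, 'I_(k i) -> A) (b' : forall i, 'I_(l i) -> A) :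
  (forall i j, b i j = b' (s i) (g i j)) ->
  forall x, concat b x = concat b' (block_map g x).
Proof. by move=> E x; apply: etrans (esym (concat_Rank b' _)); exact: E. Qed.

(* The order-preserving identification of the two bracketings of an iterated
   concatenation. *)
Definition assoc_map n (k : 'I_n -> nat) (l : forall i, 'I_(k i) -> nat) :
    'I_(\sum_x concat l x)%N -> 'I_(\sum_i \sum_j l i j)%N :=
  fun z => tagnat.Rank (tagnat.sig1 (tagnat.sig1 z))
             (tagnat.Rank (tagnat.sig2 (tagnat.sig1 z)) (tagnat.sig2 z)).

Section AssocMap.

Variables (n : nat) (k : 'I_n -> nat) (l : forall i, 'I_(k i) -> nat).
Arguments l : clear implicits.

Let pos2 (p : {i & 'I_(k i)}) (c : 'I_(l (tag p) (tagged p))) :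
    'I_(\sum_i \sum_j l i j)%N := tagnat.Rank (tag p) (tagnat.Rank (tagged p) c).

Let pos2_eq p p' (c : 'I_(l (tag p) (tagged p)))
    (c' : 'I_(l (tag p') (tagged p'))) : p = p' -> c = c' :> nat -> @pos2 p c = @pos2 p' c'.
Proof. by move=> E; case: _ / E c' => c' /ord_inj ->. Qed.

Let pos2_inj p p' (c : 'I_(l (tag p) (tagged p)))
    (c' : 'I_(l (tag p') (tagged p'))) : @pos2 p c = @pos2 p' c' -> p = p' /\ c = c' :> nat.
Proof.
move: p p' c c' => [i j] [i' j'] /= c c' /Rank_inj2 E.
have /= ii' := congr1 tag E; case: _ / ii' in j' c' E *.
have {}E := eq_from_Tagged E; move/Rank_inj2: E => E.
have /= jj' := congr1 tag E; case: _ / jj' in c' E *.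
by have -> := eq_from_Tagged E.
Qed.

Lemma assoc_map_Rank i j (c : 'I_(l i j)) :
  assoc_map (tagnat.Rank (tagnat.Rank i j) (cast_ord (esym (concat_Rank l j)) c))
  = tagnat.Rank i (tagnat.Rank j c).
Proof.
have -> : @assoc_map n k l = concat (fun x => @pos2 (tagnat.sig x)) by [].
apply: etrans (concat_Rank _ _) _; apply: (@pos2_eq _ (Tagged (fun i => 'I_(k i)) j)) => //.
exact: tagnat.rankK.
Qed.

Lemma assoc_map_bij : bijective (assoc_map (l := l)).
Proof.
apply: bij_inj_card => [x y|y].
  have E z : assoc_map z =
      @pos2 (tagnat.sig (tagnat.sig1 z)) (tagnat.sig2 z) by [].
  rewrite !E => /pos2_inj[/tagnat.sig_inj E1 E2].
  by apply: ord_inj; rewrite (tagnat.rect x) (tagnat.rect y) E2 E1.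
rewrite -[y]tagnat.sig2K -[tagnat.sig2 y]tagnat.sig2K.
by eexists; exact: assoc_map_Rank.
Qed.

Lemma assoc_map_concat (A : Type) (a : forall i j, 'I_(l i j) -> A) z :
  concat (fun x => a (tagnat.sig1 x) (tagnat.sig2 x)) z
  = concat (fun i => concat (a i)) (assoc_map z).
Proof. by rewrite /assoc_map !concat_Rank. Qed.

End AssocMap.

Lemma sig2_unit_bij n : bijective (fun x : 'I_(\sum_(i < 1) n)%N => tagnat.sig2 x).
Proof.
apply: bij_inj_card => [x y E|y].
  by apply: ord_inj; rewrite (tagnat.rect x) (tagnat.rect y) E [tagnat.sig1 x]ord1
     [tagnat.sig1 y]ord1.
exists (tagnat.Rank (p_ := fun=> n) ord0 y).
by rewrite tagnat.Rank2K; apply: val_inj.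
Qed.

Lemma sig1_unit_bij n : bijective (fun x : 'I_(\sum_(i < n) 1)%N => tagnat.sig1 x).
Proof.
apply: bij_inj_card => [x y E|y].
  by apply: ord_inj; rewrite (tagnat.rect x) (tagnat.rect y) E [tagnat.sig2 x]ord1
     [tagnat.sig2 y]ord1.
by exists (tagnat.Rank (p_ := fun=> 1%N) y ord0); rewrite tagnat.Rank1K.
Qed.

(* [op c d] is the set P(c_0, ..., c_{n-1}; d).  [act] is the action of the
   symmetric groups; the domain and codomain of the permutation f are written
   'I_m and 'I_n, and the permuted sequence c o f is only required to be
   pointwise equal to c', so that no transport along equalities of arities or
   of colour sequences is needed in the axioms. *)
Record operad := Operad {
  col : Type;
  op : forall n, ('I_n -> col) -> col -> Type;
  unit_op : forall c, op (fun _ : 'I_1 => c) c;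
  act : forall m n (f : 'I_m -> 'I_n) (c : 'I_n -> col) (c' : 'I_m -> col) d,
    bijective f -> (forall i, c' i = c (f i)) -> op c d -> op c' d;
  comp : forall n (c : 'I_n -> col) d (k : 'I_n -> nat)
      (b : forall i, 'I_(k i) -> col),
    op c d -> (forall i, op (b i) (c i)) -> op (concat b) d;

  act_id : forall n (c : 'I_n -> col) d (p : op c d),
    act (id_bij _) (fun=> erefl) p = p;
  act_comp : forall m n r (f : 'I_m -> 'I_n) (g : 'I_n -> 'I_r)
      (hf : bijective f) (hg : bijective g)
      (c : 'I_r -> col) (c' : 'I_n -> col) (c'' : 'I_m -> col) d
      (ec : forall i, c' i = c (g i)) (ec' : forall i, c'' i = c' (f i))
      (p : op c d),
    act hf ec' (act hg ec p)
    = act (bij_comp hg hf) (fun i => etrans (ec' i) (ec (f i))) p;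

  comp_unit_l : forall n (c : 'I_n -> col) d (p : op c d),
    comp (unit_op d) (fun _ : 'I_1 => p)
    = act (sig2_unit_bij n) (fun=> erefl) p;
  comp_unit_r : forall n (c : 'I_n -> col) d (p : op c d),
    comp p (fun i => unit_op (c i))
    = act (sig1_unit_bij n) (fun=> erefl) p;
  comp_assoc : forall n (c : 'I_n -> col) d (k : 'I_n -> nat)
      (b : forall i, 'I_(k i) -> col) (l : forall i, 'I_(k i) -> nat)
      (a : forall i j, 'I_(l i j) -> col)
      (p : op c d) (q : forall i, op (b i) (c i))
      (r : forall i j, op (a i j) (b i j)),
    comp (comp p q) (fun x => r (tagnat.sig1 x) (tagnat.sig2 x))
    = act (@assoc_map_bij n k l) (assoc_map_concat a)
        (comp p (fun i => comp (q i) (r i)));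

  comp_act_l : forall m n (s : 'I_m -> 'I_n) (hs : bijective s)
      (c : 'I_n -> col) d (k : 'I_n -> nat) (b : forall i, 'I_(k i) -> col)
      (p : op c d) (q : forall i, op (b i) (c i)),
    comp (act hs (fun=> erefl) p : op (fun i => c (s i)) d) (fun i => q (s i))
    = act (block_map_bij (l := k) hs (fun i => id_bij _))
        (block_map_concat (s := s) (b' := b) (fun _ _ => erefl)) (comp p q);
  comp_act_r : forall n (c : 'I_n -> col) d (k k' : 'I_n -> nat)
      (b : forall i, 'I_(k i) -> col) (b' : forall i, 'I_(k' i) -> col)
      (g : forall i, 'I_(k' i) -> 'I_(k i)) (hg : forall i, bijective (g i))
      (eb : forall i j, b' i j = b i (g i j))
      (p : op c d) (q : forall i, op (b i) (c i)),
    comp p (fun i => act (hg i) (eb i) (q i))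
    = act (block_map_bij (s := id) (id_bij _) hg)
        (block_map_concat eb) (comp p q)
}.

Record operad_hom (P Q : operad) := OperadHom {
  hcol : col P -> col Q;
  hop : forall n (c : 'I_n -> col P) d,
    op c d -> op (fun i => hcol (c i)) (hcol d);
  hop_unit : forall c, hop (unit_op c) = unit_op (hcol c);
  hop_act : forall m n (f : 'I_m -> 'I_n) (hf : bijective f)
      (c : 'I_n -> col P) (c' : 'I_m -> col P) d
      (ec : forall i, c' i = c (f i)) (p : op c d),
    hop (act hf ec p) = act hf (fun i => congr1 hcol (ec i)) (hop p);
  hop_comp : forall n (c : 'I_n -> col P) d (k : 'I_n -> nat)
      (b : forall i, 'I_(k i) -> col P)
      (p : op c d) (q : forall i, op (b i) (c i)),
    hop (comp p q) = comp (hop p) (fun i => hop (q i))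
}.

Section OperadCategory.

Definition operad_id (P : operad) : operad_hom P P.
Proof.
exists id (fun n c d p => p) => // *.
by congr act; apply: proof_irrelevance.
Defined.

Definition operad_comp (P Q R : operad) (g : operad_hom Q R)
  (f : operad_hom P Q) : operad_hom P R.
Proof.
exists (fun c => hcol g (hcol f c)) (fun n c d p => hop g (hop f p)) => *.
- by rewrite !hop_unit.
- by rewrite !hop_act; congr act; apply: proof_irrelevance.
- by rewrite !hop_comp.
Defined.

(* Two operad maps with the same underlying functions are equal. *)
Lemma operad_hom_eq (P Q : operad) h (o : forall n (c : 'I_n -> col P) d,
    op c d -> op (fun i => h (c i)) (h d)) u a k u' a' k' :
  @OperadHom P Q h o u a k = @OperadHom P Q h o u' a' k'.
Proof. by congr OperadHom; apply: proof_irrelevance. Qed.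

Lemma operad_comp_id_l (P Q : operad) (f : operad_hom P Q) :
  operad_comp (operad_id Q) f = f.
Proof. by case: f => *; apply: operad_hom_eq. Qed.

Lemma operad_comp_id_r (P Q : operad) (f : operad_hom P Q) :
  operad_comp f (operad_id P) = f.
Proof. by case: f => *; apply: operad_hom_eq. Qed.

Lemma operad_comp_assoc (P Q R S : operad) (h : operad_hom R S)
    (g : operad_hom Q R) (f : operad_hom P Q) :
  operad_comp h (operad_comp g f) = operad_comp (operad_comp h g) f.
Proof. exact: operad_hom_eq. Qed.

End OperadCategory.

(* [out v] is the output edge of the vertex v and [below x] the vertex of which
   x is an input edge, if any; the root is the only edge that is not an input.
   Every edge lies over the root. *)
Definition step (E V : Type) (out : V -> E) (below : E -> option V) (x : E) : E :=
  if below x is Some v then out v else x.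

Record tree := Tree {
  edge : finType;
  vertex : finType;
  root : edge;
  out : vertex -> edge;
  below : edge -> option vertex;
  out_inj : injective out;
  below_root : forall x, below x = None <-> x = root;
  to_root : forall x, exists k, iter k (step out below) x = root
}.

Definition down (T : tree) : edge T -> edge T := step (@out T) (@below T).

Definition is_input (T : tree) (x : edge T) : bool := below x != None.
Definition is_output (T : tree) (x : edge T) : bool := x \in codom (@out T).

Definition inner (T : tree) (x : edge T) : bool := is_input x && is_output x.

Definition attached (T : tree) (v : vertex T) (x : edge T) : bool :=
  (out v == x) || (below x == Some v).

(* A subtree is given by its root r and its set W of vertices: it has the
    edges r and all inputs of vertices in W, and every vertex in W must sit on
    one of these edges. *)

Section Subtree.

Variable T : tree.
Implicit Types (W : {set vertex T}) (r x y : edge T).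

Definition inputs (v : vertex T) : {set edge T} := [set x | below x == Some v].

Definition outputs W : {set edge T} := [set out v | v in W].

Definition sub_edges W r : {set edge T} := r |: \bigcup_(v in W) inputs v.

Definition is_subtree W r : bool := outputs W \subset sub_edges W r.

Definition sub_leaves W r : {set edge T} := sub_edges W r :\: outputs W.

(* Omega(T)(e_1, ..., e_n; r) as a proposition, hence empty or a singleton. *)
Definition tree_op n (e : 'I_n -> edge T) (r : edge T) : Prop :=
  injective e /\
  exists W, is_subtree W r /\ sub_leaves W r = [set e i | i : 'I_n].

Lemma down_root : down (root T) = root T.
Proof. by rewrite /down /step (below_root _).2. Qed.

Lemma iter_root k : iter k (@down T) (root T) = root T.
Proof. by elim: k => //= k ->; rewrite down_root. Qed.

Lemma below_down x v : below x = Some v -> down x = out v.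
Proof. by rewrite /down /step => ->. Qed.

Definition under x y := exists k, iter k (@down T) y = x.

Lemma under_refl x : under x x. Proof. by exists 0. Qed.

Lemma under_trans y x z : under x y -> under y z -> under x z.
Proof. by move=> [k <-] [l <-]; exists (k + l); rewrite iterD. Qed.

Lemma under_loop m x : iter m.+1 (@down T) x = x -> x = root T.
Proof.
move=> E; have [k kx] := to_root x.
have E' j : iter (j * m.+1) (@down T) x = x.
  by elim: j => [//|j IH]; rewrite mulSn iterD IH.
by have := E' k; rewrite mulnS addnC iterD [iter k _ x]kx iter_root => <-.
Qed.

Lemma under_antisym x y : under x y -> under y x -> x = y.
Proof.
move=> [[|k] E] [l E']; first by rewrite -E.
have /under_loop xr : iter (k + l).+1 (@down T) x = x.
  by rewrite -addSn iterD E' E.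
by rewrite -E' xr iter_root.
Qed.

Lemma under_total x y z : under x z -> under y z -> under x y \/ under y x.
Proof.
move=> [k <-] [l <-]; case: (leqP k l) => kl.
  by right; exists (l - k); rewrite -iterD subnK.
by left; exists (k - l); rewrite -iterD subnK // ltnW.
Qed.

Lemma sub_edgesP W r x : reflect (x = r \/ exists2 v, v \in W & below x = Some v)
  (x \in sub_edges W r).
Proof.
rewrite !inE; apply: (iffP orP) => [[/eqP|/bigcupP[v vW]]|[->|[v vW E]]].
- by left.
- by rewrite inE => /eqP E; right; exists v.
- by left.
- by right; apply/bigcupP; exists v; rewrite ?inE ?E.
Qed.

Lemma sub_leavesP W r x : reflect (x \in sub_edges W r /\ x \notin outputs W)
  (x \in sub_leaves W r).
Proof. by rewrite in_setD andbC; apply: andP. Qed.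

Lemma out_under W r v : is_subtree W r -> v \in W -> under r (out v).
Proof.
move=> /subsetP sW; have [k] := to_root (out v).
elim: k v => [|k IH] v E vW.
  have /sub_edgesP[->|[u uW]] := sW _ (imset_f (@out T) vW).
    exact: under_refl.
  by rewrite [out v]E (below_root _).2.
have /sub_edgesP[->|[u uW bu]] := sW _ (imset_f (@out T) vW).
  exact: under_refl.
have E' : down (out v) = out u by exact: below_down.
apply: (@under_trans (out u)); last by exists 1; rewrite /= E'.
by apply: IH => //; rewrite -E' -[RHS]E [RHS]iterSr.
Qed.

Lemma edge_under W r x : is_subtree W r -> x \in sub_edges W r -> under r x.
Proof.
move=> sW /sub_edgesP[->|[u uW bu]]; first exact: under_refl.
apply: (@under_trans (out u)); first exact: (out_under sW uW).
by exists 1; rewrite /= (below_down bu).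
Qed.

Lemma under_output W r x y : is_subtree W r -> x \in sub_edges W r ->
  under r y -> under y x -> y = x \/ y \in outputs W.
Proof.
move=> sW xW ry [k]; elim: k x xW => [|k IH] x xW; first by left.
rewrite iterSr => E; have /sub_edgesP[xr|[u uW bu]] := xW.
  left; apply: under_antisym; last by rewrite xr.
  by exists k.+1; rewrite iterSr.
have oW : out u \in outputs W by apply: imset_f.
rewrite (below_down bu) in E.
by have [->|] := IH _ (subsetP sW _ oW) E; right.
Qed.

Lemma leaf_under W r x y : is_subtree W r -> x \in sub_leaves W r ->
  y \in sub_leaves W r -> under x y -> x = y.
Proof.
move=> sW /sub_leavesP[xW xo] /sub_leavesP[yW yo] xy.
have [//|xo'] := under_output sW yW (edge_under sW xW) xy.
by rewrite xo' in xo.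
Qed.

Lemma tree_op_unit e : tree_op (fun _ : 'I_1 => e) e.
Proof.
split=> [i j _|]; first by rewrite !ord1.
exists set0; rewrite /is_subtree /sub_leaves /outputs imset0 sub0set setD0.
split=> //; rewrite /sub_edges big_set0 setU0.
apply/setP=> x; rewrite inE; apply/eqP/imsetP => [->|[i _ ->]] //.
by exists ord0.
Qed.

Lemma tree_op_act m n (f : 'I_m -> 'I_n) (e : 'I_n -> edge T)
    (e' : 'I_m -> edge T) r :
  bijective f -> (forall i, e' i = e (f i)) -> tree_op e r -> tree_op e' r.
Proof.
move=> fb E [ei [W [sW lW]]]; split=> [i j|].
  by rewrite !E => /ei; apply: bij_inj.
exists W; split=> //; rewrite lW; have [g fg gf] := fb.
apply/setP=> x; apply/imsetP/imsetP => -[i _ ->].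
  by exists (g i); rewrite // E gf.
by exists (f i).
Qed.

Lemma tree_op_comp n (c : 'I_n -> edge T) r (k : 'I_n -> nat)
    (b : forall i, 'I_(k i) -> edge T) :
  tree_op c r -> (forall i, tree_op (b i) (c i)) -> tree_op (concat b) r.
Proof.
move=> [ci [W [sW lW]]] H.
have [U HU] : exists U : 'I_n -> {set vertex T}, forall i,
    is_subtree (U i) (c i) /\ sub_leaves (U i) (c i) = [set b i j | j : 'I_(k i)].
  suff Hp i : exists X, is_subtree X (c i) &&
      (sub_leaves X (c i) == [set b i j | j : 'I_(k i)]).
    by exists (fun i => xchoose (Hp i)) => i; have /andP[-> /eqP] := xchooseP (Hp i).
  by have [_ [X [sX /eqP lX]]] := H i; exists X; rewrite sX.
have bi i : injective (b i) by have [] := H i.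
have sU i : is_subtree (U i) (c i) by have [] := HU i.
have lU i j : b i j \in sub_leaves (U i) (c i).
  by have [_ ->] := HU i; apply: imset_f.
have cW i : c i \in sub_leaves W r by rewrite lW; apply: imset_f.
have cb i j : under (c i) (b i j).
  by apply: edge_under (sU i) _; have /sub_leavesP[] := lU i j.
have c_eq i i' x : under (c i) x -> under (c i') x -> i = i'.
  move=> h h'; apply: ci; have [h2|h2] := under_total h h'.
    exact: (leaf_under sW).
  by apply/esym/(leaf_under sW).
have inE' i : c i \in sub_edges W r by have /sub_leavesP[] := cW i.
have ninE i : c i \notin outputs W by have /sub_leavesP[] := cW i.
pose X := W :|: \bigcup_i U i.
have WX x : x \in sub_edges W r -> x \in sub_edges X r.
  case/sub_edgesP => [->|[v vW bv]]; apply/sub_edgesP; first by left.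
  by right; exists v; rewrite // inE vW.
have UX i x : x \in sub_edges (U i) (c i) -> x \in sub_edges X r.
  case/sub_edgesP => [->|[v vU bv]]; first exact: WX.
  apply/sub_edgesP; right; exists v; rewrite // inE; apply/orP; right.
  by apply/bigcupP; exists i.
split.
  move=> x y E; apply: tagnat.sig_inj; rewrite !tagnat.sigE12.
  move: E; rewrite /concat; move: (tagnat.sig1 x) (tagnat.sig2 x).
  move=> i j; move: (tagnat.sig1 y) (tagnat.sig2 y) => i' j' E.
  have ii' : i = i' by apply: (c_eq _ _ (b i j)); rewrite // E.
  by case: _ / ii' in j' E *; have -> := bi _ _ _ E.
exists X; split.
  apply/subsetP=> _ /imsetP[v + ->]; rewrite inE => /orP[vW|/bigcupP[i _ vU]].
    by apply/WX/(subsetP sW)/imset_f.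
  by apply: (UX i); apply: (subsetP (sU i)); apply: imset_f.
apply/setP=> x; apply/sub_leavesP/imsetP => [[xX xo]|[y _ ->]].
  have noW : x \notin outputs W.
    apply: contra xo => /imsetP[v vW ->]; apply: imset_f.
    by rewrite inE vW.
  have noU i : x \notin outputs (U i).
    apply: contra xo => /imsetP[v vW ->]; apply: imset_f.
    by rewrite inE; apply/orP; right; apply/bigcupP; exists i.
  suff [i xi] : exists i, x \in sub_leaves (U i) (c i).
    move: xi; have [_ ->] := HU i; case/imsetP=> j _ ->.
    by exists (tagnat.Rank i j); rewrite ?concat_Rank.
  have leafW : x \in sub_edges W r -> exists i, x \in sub_leaves (U i) (c i).
    move=> xW; have : x \in sub_leaves W r by apply/sub_leavesP.
    rewrite lW => /imsetP[i _ xi]; exists i; apply/sub_leavesP; split=> //.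
    by apply/sub_edgesP; left.
  case/sub_edgesP: (xX) => [xr|[v + bv]].
    by apply: leafW; apply/sub_edgesP; left.
  rewrite inE => /orP[vW|/bigcupP[i _ vU]].
    by apply: leafW; apply/sub_edgesP; right; exists v.
  by exists i; apply/sub_leavesP; split=> //; apply/sub_edgesP; right; exists v.
rewrite /concat; move: (tagnat.sig1 y) (tagnat.sig2 y) => i j.
have /sub_leavesP[eU nU] := lU i j.
split; first exact: UX eU.
apply/negP=> /imsetP[v + bv]; rewrite inE => /orP[vW|/bigcupP[i' _ vU]].
  have oW : b i j \in outputs W by rewrite bv; apply: imset_f.
  have [E|] := under_output sW (subsetP sW _ oW) (edge_under sW (inE' i)) (cb i j).
    by have := ninE i; rewrite E oW.
  exact/negP.
have ii' : i' = i.
  by apply: (c_eq _ _ (b i j)) => //; rewrite bv; apply: out_under vU.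
by move: nU; rewrite bv -ii' => /negP; apply; apply: imset_f.
Qed.

End Subtree.

Definition tree_operad (T : tree) : operad.
Proof.
refine (@Operad (edge T) (@tree_op T) (@tree_op_unit T)
  (fun m n f c c' d => @tree_op_act T m n f c c' d)
  (fun n c d k b => @tree_op_comp T n c d k b) _ _ _ _ _ _ _);
  by intros; apply proof_irrelevance.
Defined.

Lemma tree_op_irr (T : tree) n (e : 'I_n -> col (tree_operad T)) r
  (p q : op e r) : p = q.
Proof. exact: (proof_irrelevance (tree_op e r)). Qed.

Definition tree_map (S T : tree) := operad_hom (tree_operad S) (tree_operad T).

(* As the sets of operations of Omega(T) have at most one element, an operad map
   into Omega(T) amounts to a map of colours preserving inhabited operations. *)
Definition tree_map_of (S T : tree) (h : edge S -> edge T)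
  (H : forall n (e : 'I_n -> edge S) r, tree_op e r ->
       tree_op (fun i => h (e i)) (h r)) : tree_map S T.
Proof.
refine (@OperadHom (tree_operad S) (tree_operad T) h H _ _ _);
  by move=> *; apply: tree_op_irr.
Defined.

Lemma tree_op_inj (S T : tree) (h : edge S -> edge T)
    (w : {set vertex S} -> {set vertex T}) :
  injective h ->
  (forall W r, is_subtree W r -> is_subtree (w W) (h r)) ->
  (forall W r, is_subtree W r -> sub_leaves (w W) (h r) = h @: sub_leaves W r) ->
  forall n (e : 'I_n -> edge S) r, tree_op e r ->
    tree_op (fun i => h (e i)) (h r).
Proof.
move=> hi Hs Hl n e r [ei [W [sW lW]]]; split; first by move=> i j /hi /ei.
exists (w W); split; first exact: Hs.
by rewrite Hl // lW -imset_comp.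
Qed.

Definition eta : tree.
Proof.
refine (@Tree unit void tt (fun v => match v with end) (fun=> None) _ _ _).
- by case.
- by case.
- by case; exists 0.
Defined.

Section InnerFace.

Variables (T : tree) (e : edge T).

Definition contract_edge : finType := {x : edge T | x != e}.
Definition contract_vertex : finType := {v : vertex T | out v != e}.

(* The inputs of the vertex above e become inputs of the vertex below e. *)
Definition contract_below0 (x : edge T) : option (vertex T) :=
  if below x is Some v then if out v == e then below e else Some v else None.

Definition contract_below (x : contract_edge) : option contract_vertex :=
  obind insub (contract_below0 (val x)).

Definition contract_out (v : contract_vertex) : contract_edge :=
  exist _ (out (val v)) (valP v).

Hypothesis he : inner e.

Lemma inner_root : root T != e.
Proof.
case/andP: he => he' _; apply: contraNneq he' => <-.
exact/eqP/(below_root _).2.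
Qed.

Definition contract_root : contract_edge := exist _ (root T) inner_root.

Lemma down_fix (x : edge T) : down x = x -> x = root T.
Proof. by move=> E; apply: (@under_loop T 0). Qed.

Lemma contract_belowE (x : contract_edge) : below (val x) = None \/
  exists v, below (val x) = Some v /\ 
   exists2 w : contract_vertex, contract_below x = Some w &
     (out v != e /\ val w = v) \/ (out v = e /\ below e = Some (val w)).
Proof.
rewrite /contract_below /contract_below0.
case E: (below _) => [v|]; last by left.
right; exists v; split=> //; case: eqP => ve.
  case/andP: (he); rewrite /is_input; case Ee: (below e) => [w|] // _ _.
  have we : out w != e.
    apply/eqP => we; have /down_fix er : down e = e by rewrite (below_down Ee).
    by have := inner_root; rewrite -er eqxx.
  exists (exist _ w we); last by right.
  by rewrite /= insubT.
have ve' : out v != e by apply/eqP.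
by exists (exist _ v ve'); [rewrite /= insubT | left].
Qed.

Lemma contract_out_inj : injective contract_out.
Proof.
move=> v w /(congr1 val) /= /(@out_inj T); exact: val_inj.
Qed.

Lemma contract_below_root x : contract_below x = None <-> x = contract_root.
Proof.
split=> [H|->].
  have [/below_root E|[v [_ [w E _]]]] := contract_belowE x; first exact: val_inj.
  by rewrite H in E.
by rewrite /contract_below /contract_below0 /= (below_root _).2.
Qed.

Lemma contract_to_root x :
  exists k, iter k (step contract_out contract_below) x = contract_root.
Proof.
have [k] := to_root (val x); have [m] := ubnP k.
elim: m k x => // m IH k x; rewrite ltnS => km.
case: k km => [|k] km; first by move=> /= E; exists 0; apply: val_inj.
rewrite iterSr -/(down _).
have [B|[v [B [w Bw C]]]] := contract_belowE x.
  by exists 0; apply/val_inj/below_root.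
have [l E] : exists l, l <= k /\
    (iter k (@down T) (out v) = root T ->
     iter l (@down T) (out (val w)) = root T).
  case: C => [[_ ->]|[-> Be]]; first by exists k.
  case: k {km} => [|k]; first by exists 0; split=> //= /eqP; rewrite eq_sym (negPf inner_root).
  by exists k; rewrite leqnSn iterSr (below_down Be).
case: E => lk E; rewrite (below_down B) => /E E'.
have [j Hj] := IH l (contract_out w) (leq_ltn_trans lk km) E'.
by exists j.+1; rewrite iterSr /step Bw.
Qed.

Definition contract : tree :=
  Tree contract_out_inj contract_below_root contract_to_root.

Definition contract_lift (W : {set contract_vertex}) : {set vertex T} :=
  val @: W :|: [set v | (out v == e) && (below e \in [set Some (val w) | w in W])].

Lemma contract_liftP (W : {set contract_vertex}) v : reflect
  ((exists2 w, w \in W & v = val w) \/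
   (out v = e /\ exists2 w, w \in W & below e = Some (val w)))
  (v \in contract_lift W).
Proof.
rewrite !inE; apply: (iffP orP) => -[].
- by case/imsetP=> w wW ->; left; exists w.
- by case/andP=> /eqP ve /imsetP[w wW we]; right; split=> //; exists w.
- by case=> w wW ->; left; apply: imset_f.
- case=> -> [w wW ->]; right; rewrite eqxx.
  by apply/imsetP; exists w.
Qed.

Lemma contract_lift_val W (w : contract_vertex) :
  (val w \in contract_lift W) = (w \in W).
Proof.
apply/contract_liftP/idP => [[[w' ? /val_inj -> //]|[we _]]|wW].
  by have := valP w; rewrite /= we eqxx.
by left; exists w.
Qed.

Lemma contract_lift_above W v (w : contract_vertex) :
  out v = e -> below e = Some (val w) -> (v \in contract_lift W) = (w \in W).
Proof.
move=> ve we; apply/contract_liftP/idP => [[[w' _ vw]|[_ [w' w'W]]]|wW].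
- by have := valP w'; rewrite /= -vw ve eqxx.
- by rewrite we => -[/val_inj ->].
- by right; split=> //; exists w.
Qed.

Lemma contract_sub_edges (W : {set contract_vertex}) (r x : contract_edge) :
  (val x \in sub_edges (contract_lift W) (val r))
  = (x \in @sub_edges contract W r).
Proof.
have [B|[v [B [w Bw C]]]] := contract_belowE x.
  apply/sub_edgesP/sub_edgesP => -[|[v _ E]].
  - by move/val_inj; left.
  - by rewrite B in E.
  - by move->; left.
  by move: E; rewrite /= /contract_below /contract_below0 B.
have vw : (v \in contract_lift W) = (w \in W).
  case: C => [[_ <-]|[ve we]]; first exact: contract_lift_val.
  exact: contract_lift_above.
apply/sub_edgesP/sub_edgesP => -[|[u uW E]].
- by move/val_inj; left.
- by right; exists w; rewrite // -vw; move: E uW; rewrite B => -[->].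
- by move->; left.
- right; exists v => //; rewrite vw; move: E uW.
  by rewrite /= Bw => -[->].
Qed.

Lemma contract_outputs (W : {set contract_vertex}) (x : contract_edge) :
  (val x \in outputs (contract_lift W)) = (x \in @outputs contract W).
Proof.
apply/imsetP/imsetP => -[v].
  case/contract_liftP => [[w wW ->] E|[ve _] E].
    by exists w => //; apply: val_inj.
  by have := valP x; rewrite /= E ve eqxx.
by move=> vW ->; exists (val v); rewrite ?contract_lift_val.
Qed.

Lemma contract_subtree (W : {set contract_vertex}) (r : contract_edge) :
  @is_subtree contract W r -> is_subtree (contract_lift W) (val r).
Proof.
move=> /subsetP sW; apply/subsetP=> _ /imsetP[v /contract_liftP vW ->].
case: vW => [[w wW ->]|[-> [w wW we]]].
  rewrite -[out _]/(val (contract_out w)) contract_sub_edges.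
  by apply: sW; apply: (imset_f (@out contract)).
apply/sub_edgesP; right; exists (val w) => //.
by rewrite contract_lift_val.
Qed.

Lemma contract_leaves (W : {set contract_vertex}) (r : contract_edge) :
  @is_subtree contract W r ->
  sub_leaves (contract_lift W) (val r) = val @: @sub_leaves contract W r.
Proof.
move=> _; apply/setP => x; apply/sub_leavesP/imsetP => [[xW xo]|[y + ->]]; last first.
  by case/sub_leavesP; rewrite -contract_sub_edges -contract_outputs.
have xe : x != e.
  apply/eqP => xe; rewrite {x}xe in xW xo.
  case/sub_edgesP: xW => [er|[v vW be]].
    by have := valP r; rewrite /= -er eqxx.
  case/andP: he => _ /codomP[u ue].
  case/contract_liftP: vW => [[w wW vw]|[ve _]].
    move: xo; rewrite {1}ue imset_f //.
    by rewrite (contract_lift_above _ _ (w := w)) // be vw.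
  have /down_fix er : down e = e by rewrite (below_down be).
  by have := inner_root; rewrite -er eqxx.
exists (exist _ x xe) => //; apply/sub_leavesP.
by rewrite -contract_sub_edges -contract_outputs.
Qed.

Definition inner_face : tree_map contract T :=
  tree_map_of (@tree_op_inj contract T val _ val_inj 
    contract_subtree contract_leaves).

End InnerFace.

Section OuterFace.

Variables (T : tree) (v : vertex T).

Definition prune_edge : finType := {x : edge T | attached v x ==> inner x}.
Definition prune_vertex : finType := {u : vertex T | u != v}.

Definition outer_vertex : bool := #|[pred x | attached v x && inner x]| == 1.

Hypothesis hv : outer_vertex.

Lemma inner_not_root (x : edge T) : inner x -> x != root T.
Proof.
by case/andP=> xi _; apply: contraNneq xi => ->; apply/eqP/(below_root _).2.
Qed.

Lemma inner_unique x y : attached v x -> inner x -> attached v y -> inner y -> x = y.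
Proof.
move=> ax ix ay iy; have [z Hz] := mem_card1 (eqP hv).
by have := Hz x; have := Hz y; rewrite !inE ax ix ay iy => /esym/eqP -> /esym/eqP ->.
Qed.

(* If v is the root vertex, the only inner edge attached to it becomes the root. *)
Definition prune_root0 : edge T :=
  if out v == root T
  then odflt (root T) [pick x | attached v x && inner x] else root T.

Lemma prune_root_subproof : attached v prune_root0 ==> inner prune_root0.
Proof.
apply/implyP; rewrite /prune_root0; case: eqP => [_|vr].
  case: pickP => [x /andP[//]|E _].
  by move: hv; rewrite /outer_vertex eq_card0.
by rewrite /attached (below_root _).2 //= orbF => /eqP.
Qed.

Definition prune_root : prune_edge := exist _ prune_root0 prune_root_subproof.

Lemma prune_out_subproof (u : prune_vertex) :
  attached v (out (val u)) ==> inner (out (val u)).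
Proof.
apply/implyP=> /orP[/eqP/(@out_inj T) E|/eqP E].
  by have /eqP[] := valP u.
by rewrite /inner /is_input /is_output E codom_f.
Qed.

Definition prune_out (u : prune_vertex) : prune_edge :=
  exist _ (out (val u)) (prune_out_subproof u).

Definition prune_below (x : prune_edge) : option prune_vertex :=
  obind insub (below (val x)).

Lemma prune_out_inj : injective prune_out.
Proof. by move=> u w /(congr1 val) /= /(@out_inj T); exact: val_inj. Qed.

Lemma prune_below_root x : prune_below x = None <-> x = prune_root.
Proof.
rewrite /prune_below; split.
  case E: (below _) => [u|] /=; last first.
    move=> _; apply: val_inj; rewrite /= /prune_root0.
    have xr : val x = root T by apply/below_root.
    case: eqP => // vr; have := valP x.
    rewrite /= /attached xr vr eqxx /= => /inner_not_root.
    by rewrite eqxx.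
  case: insubP => // /negPn /eqP uv _; rewrite {u}uv in E.
  have ax : attached v (val x) by rewrite /attached E eqxx orbT.
  have ix : inner (val x) by have := valP x; rewrite /= ax.
  apply: val_inj; rewrite /= /prune_root0.
  case: eqP => vr.
    case: pickP => [y /andP[ay iy]|/(_ (val x))]; last by rewrite ax ix.
    exact: inner_unique.
  have av : attached v (out v) by rewrite /attached eqxx.
  have iv : inner (out v).
    rewrite /inner /is_input /is_output codom_f andbT.
    by apply/eqP => /below_root.
  have xv := inner_unique ax ix av iv.
  have /down_fix : down (out v) = out v by rewrite (@below_down _ _ v) // -xv.
  by move/vr.
move=> ->; rewrite /= /prune_root0; case: eqP => [vr|_]; last first.
  by rewrite (below_root _).2.
case: pickP => [y /andP[/orP[/eqP vx|/eqP bx] ix]|_] /=.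
- by have := inner_not_root ix; rewrite -vx vr eqxx.
- by rewrite bx /= insubF ?eqxx.
- by rewrite (below_root _).2.
Qed.

Lemma prune_belowE (x : prune_edge) (u : prune_vertex) :
  prune_below x = Some u <-> below (val x) = Some (val u).
Proof.
rewrite /prune_below; split=> [|->] /=; last by rewrite valK.
by case: (below _) => //= w; case: insubP => // u' _ <- [->].
Qed.

Lemma prune_to_root x :
  exists k, iter k (step prune_out prune_below) x = prune_root.
Proof.
have [k] := to_root (val x); elim: k x => [|k IH] x E.
  by exists 0; apply/prune_below_root; rewrite /prune_below (below_root _).2.
case Ex: (prune_below x) => [u|]; last by exists 0; apply/prune_below_root.
have Ex' := (prune_belowE _ _).1 Ex.
rewrite iterSr -/(down _) (below_down Ex') in E.
have [l El] := IH (prune_out u) E.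
by exists l.+1; rewrite iterSr /step Ex.
Qed.

Definition prune : tree := Tree prune_out_inj prune_below_root prune_to_root.

Definition prune_lift (W : {set prune_vertex}) : {set vertex T} := val @: W.

Lemma prune_lift_val W (w : prune_vertex) : (val w \in prune_lift W) = (w \in W).
Proof. by rewrite mem_imset //; exact: val_inj. Qed.

Lemma prune_sub_edges (W : {set prune_vertex}) (r : prune_edge) :
  sub_edges (prune_lift W) (val r) = val @: @sub_edges prune W r.
Proof.
apply/setP=> x; apply/sub_edgesP/imsetP.
  case=> [->|[_ /imsetP[u uW ->] bx]].
    by exists r => //; apply/sub_edgesP; left.
  have hx : attached v x ==> inner x.
    apply/implyP => /orP[/eqP vx|].
      by rewrite /inner /is_input /is_output bx -vx codom_f.
    by rewrite bx => /eqP[uv]; have := valP u; rewrite /= uv eqxx.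
  exists (exist _ x hx) => //; apply/sub_edgesP; right.
  by exists u => //; apply/prune_belowE.
case=> y /sub_edgesP[->|[u uW by_]] ->; first by left.
by right; exists (val u); rewrite ?prune_lift_val //; apply/prune_belowE.
Qed.

Lemma prune_outputs (W : {set prune_vertex}) :
  outputs (prune_lift W) = val @: @outputs prune W.
Proof. by rewrite /outputs /prune_lift -!imset_comp. Qed.

Lemma prune_subtree (W : {set prune_vertex}) (r : prune_edge) :
  @is_subtree prune W r -> is_subtree (prune_lift W) (val r).
Proof. by rewrite /is_subtree prune_sub_edges prune_outputs; exact: imsetS. Qed.

Lemma prune_leaves (W : {set prune_vertex}) (r : prune_edge) :
  @is_subtree prune W r ->
  sub_leaves (prune_lift W) (val r) = val @: @sub_leaves prune W r.
Proof.
move=> _; rewrite /sub_leaves prune_sub_edges prune_outputs.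
apply/setP=> x; rewrite in_setD; apply/andP/imsetP.
  case=> xo /imsetP[y yW xy]; exists y => //; rewrite in_setD yW andbT.
  by apply: contra xo => yo; rewrite xy imset_f.
case=> y; rewrite in_setD => /andP[yo yW] ->; split; last exact: imset_f.
by rewrite mem_imset //; exact: val_inj.
Qed.

Definition outer_face : tree_map prune T :=
  tree_map_of (@tree_op_inj prune T val _ val_inj 
    prune_subtree prune_leaves).

End OuterFace.

Section EdgeFace.

Variables (T : tree) (e : edge T).

Lemma edge_face_op n (d : 'I_n -> edge eta) r :
  tree_op d r -> tree_op (fun _ : 'I_n => e) e.
Proof.
case=> di [W [_ lW]].
have n1 : n = 1.
  have /eqP := congr1 (fun A : {set unit} => #|A|) lW.
  have -> : sub_leaves W r = [set tt].
    apply/setP=> -[]; rewrite !inE; apply/andP; split; last by case: (r).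
    by apply/imsetP => -[[]].
  by rewrite cards1 card_imset // card_ord eq_sym => /eqP.
case: _ / (esym n1) in d di lW *; exact: tree_op_unit.
Qed.

Definition edge_face : tree_map eta T := tree_map_of edge_face_op.

End EdgeFace.

Inductive face (T : tree) :=
  | InnerFace e of @inner T e
  | OuterFace v of @outer_vertex T v
  | EdgeFace (e : edge T) of #|vertex T| == 1.

Definition face_dom (T : tree) (f : face T) : tree :=
  match f with
  | InnerFace e he => contract he
  | OuterFace v hv => prune hv
  | EdgeFace _ _ => eta
  end.

Definition face_map (T : tree) (f : face T) : tree_map (face_dom f) T :=
  match f with
  | InnerFace e he => inner_face he
  | OuterFace v hv => outer_face hv
  | EdgeFace e _ => edge_face e
  end.

Record dset := DSet {
  cell : tree -> Type;
  restr : forall S T, tree_map S T -> cell T -> cell S;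
  restr_id : forall T (x : cell T), restr (operad_id (tree_operad T)) x = x;
  restr_comp : forall R S T (g : tree_map S T) (f : tree_map R S) (x : cell T),
    restr (operad_comp g f) x = restr f (restr g x)
}.

Record dmap (X Y : dset) := DMap {
  dfun : forall T, cell X T -> cell Y T;
  dfun_nat : forall S T (f : tree_map S T) (x : cell X T),
    dfun (restr f x) = restr f (dfun x)
}.

Definition dmap_comp (X Y Z : dset) (g : dmap Y Z) (f : dmap X Y) : dmap X Z.
Proof.
exists (fun T x => dfun g (dfun f x)) => S T h x.
by rewrite !dfun_nat.
Defined.

Definition nerve (P : operad) : dset.
Proof.
refine (@DSet (fun T => operad_hom (tree_operad T) P)
  (fun S T f x => operad_comp x f) _ _) => *.
- exact: operad_comp_id_r.
- exact: operad_comp_assoc.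
Defined.

(* Arrows of Omega are operad maps, so this is the nerve of Omega(T). *)
Definition representable (T : tree) : dset.
Proof.
refine (@DSet (fun S => tree_map S T) (fun R S f x => operad_comp x f) _ _) => *.
- exact: operad_comp_id_r.
- exact: operad_comp_assoc.
Defined.

(* The union of the images of all faces of T except the inner face of e. *)
Definition in_inner_horn (T : tree) (e : edge T) (he : inner e) (S : tree)
    (x : tree_map S T) : Prop :=
  exists f : face T, f <> InnerFace he /\
    exists y : tree_map S (face_dom f), x = operad_comp (face_map f) y.

Lemma in_inner_horn_restr (T : tree) (e : edge T) (he : inner e) R S
    (f : tree_map R S) (x : tree_map S T) :
  in_inner_horn he x -> in_inner_horn he (operad_comp x f).
Proof.
case=> g [ge [y ->]]; exists g; split=> //; exists (operad_comp y f).
by rewrite operad_comp_assoc.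
Qed.

Definition inner_horn (T : tree) (e : edge T) (he : inner e) : dset.
Proof.
refine (@DSet (fun S => {x : tree_map S T | in_inner_horn he x})
  (fun R S f x => exist _ (operad_comp (proj1_sig x) f)
                    (in_inner_horn_restr f (proj2_sig x))) _ _).
- move=> S [x hx]; apply: eq_sig_hprop => [y p q|] /=; last exact: operad_comp_id_r.
  exact: proof_irrelevance.
- move=> R S U g f [x hx]; apply: eq_sig_hprop => [y p q|] /=.
    exact: proof_irrelevance.
  exact: operad_comp_assoc.
Defined.

Definition horn_incl (T : tree) (e : edge T) (he : inner e) :
  dmap (inner_horn he) (representable T).
Proof. by exists (fun S x => proj1_sig x). Defined.

Definition strict_inner_Kan (K : dset) : Prop :=
  forall (T : tree) (e : edge T) (he : inner e),
    bijective (fun x : dmap (representable T) K => dmap_comp x (horn_incl he)).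

(* Main.v *)
(* By Yoneda, the claim is that a map x from the inner horn of T at e to the
   nerve of P extends to a unique operad map F : Omega(T) -> P.  Omega(T) is
   freely generated by the vertices of T, and the corolla of every vertex lies
   in an outer face, hence in the horn, because T has at least two vertices.
   This gives uniqueness, and it defines F by freeness from the values of x at
   corollas.  It remains to check F = x on the faces of T.  On an outer face
   both are determined by the same corollas.  In an inner face of an edge
   f <> e the only new vertex comes from the two vertices joined by f; these
   are not all the vertices of T, so their union already lies in an outer face. *)
From mathcomp Require Import all_boot all_order.
From Stdlib Require Import ProofIrrelevance FunctionalExtensionality.
From Stdlib Require Import ClassicalEpsilon.
Require Import Defs.

Set Implicit Arguments.
Unset Strict Implicit.
Unset Printing Implicit Defensive.

(** * Reindexing along bijections *)

Lemma same_image_bij (A : eqType) m n (b : 'I_n -> A) (b' : 'I_m -> A) :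
  injective b -> injective b' ->
  (forall j, exists i, b' j = b i) -> (forall i, exists j, b i = b' j) ->
  exists f : 'I_m -> 'I_n, bijective f /\ forall j, b' j = b (f j).
Proof.
move=> bi bi' /fin_all_exists[f Ef] sur; exists f; split=> //.
apply: bij_inj_card => [j j' E|i]; first by apply: bi'; rewrite !Ef E.
by have [j Ej] := sur i; exists j; apply: bi; rewrite -Ef.
Qed.

(** The laws [comp_act_l] and [comp_assoc] speak of families that factor through a given map; this
    brings an arbitrary family of grafted operations into that form. *)
Lemma bij_reindex (X Y : Type) (B : Y -> Type) (f : X -> Y)
    (t : forall x, B (f x)) :
  bijective f -> exists t' : forall y, B y, t = fun x => t' (f x).
Proof.
case=> g fg gf; exists (fun y => eq_rect _ B (t (g y)) _ (gf y)).
apply: functional_extensionality_dep => x; move: (gf (f x)); rewrite fg => E.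
by rewrite (proof_irrelevance _ E erefl).
Qed.

(** * Equality of operations with different colours *)

Section Operads.

Variable P : operad.

(** Heterogeneous equality with only the arity fixed: operations whose colours are merely provably
    equal are compared without transports. *)
Inductive op_eq n (c : 'I_n -> col P) d (p : op c d) :
    forall c' d', op (n := n) c' d' -> Prop :=
  op_eq_refl : op_eq p p.

Lemma op_eqP n (c : 'I_n -> col P) d (p p' : op c d) : op_eq p p' -> p = p'.
Proof.
move=> E; pose F (z : ('I_n -> col P) * col P) := op z.1 z.2.
suff H c' d' (q : op c' d') : op_eq p q -> existT F (c, d) p = existT F (c', d') q.
  exact: inj_pair2 (H _ _ _ E).
by case.
Qed.

Lemma op_eq_sym n (c c' : 'I_n -> col P) d d' (p : op c d) (p' : op c' d') :
  op_eq p p' -> op_eq p' p.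
Proof. by case. Qed.

Lemma op_eq_trans n (c1 c2 c3 : 'I_n -> col P) d1 d2 d3
    (p1 : op c1 d1) (p2 : op c2 d2) (p3 : op c3 d3) :
  op_eq p1 p2 -> op_eq p2 p3 -> op_eq p1 p3.
Proof. by move=> E; case. Qed.

Lemma op_eq_unit (a b : col P) : a = b -> op_eq (unit_op a) (unit_op b).
Proof. by move=> ->. Qed.

Lemma op_recolour n (c c' : 'I_n -> col P) d d' (p : op c d) :
  c =1 c' -> d = d' -> exists p' : op c' d', op_eq p' p.
Proof.
move=> /functional_extensionality Ec Ed.
by case: _ / Ec; case: _ / Ed; exists p.
Qed.

Lemma op_eq_act m n (f f' : 'I_m -> 'I_n) (hf : bijective f)
    (hf' : bijective f') (c c' : 'I_n -> col P) (b b' : 'I_m -> col P) d d'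
    (e : forall i, b i = c (f i)) (e' : forall i, b' i = c' (f' i))
    (p : op c d) (p' : op c' d') :
  f =1 f' -> op_eq p p' -> op_eq (act hf e p) (act hf' e' p').
Proof.
move=> /functional_extensionality Ef E.
case: _ / Ef in hf' e' *; case: _ _ _ / E in e' *.
have Eb : b = b' by apply: functional_extensionality => i; rewrite e e'.
case: _ / Eb in e' *; rewrite (proof_irrelevance _ hf' hf).
by rewrite (proof_irrelevance _ e' e).
Qed.

Lemma act_eq m n (f f' : 'I_m -> 'I_n) (hf : bijective f)
    (hf' : bijective f') (c : 'I_n -> col P) (b : 'I_m -> col P) d
    (e : forall i, b i = c (f i)) (e' : forall i, b i = c (f' i)) (p : op c d) :
  f =1 f' -> act hf e p = act hf' e' p.
Proof. by move=> E; apply/op_eqP/op_eq_act. Qed.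

Lemma op_eq_comp n (c c' : 'I_n -> col P) d d' (k : 'I_n -> nat)
    (b b' : forall i, 'I_(k i) -> col P) (p : op c d) (p' : op c' d')
    (q : forall i, op (b i) (c i)) (q' : forall i, op (b' i) (c' i)) :
  op_eq p p' -> (forall i, op_eq (q i) (q' i)) ->
  op_eq (comp p q) (comp p' q').
Proof.
move=> E; case: _ _ _ / E in q' * => Eq.
have Eb : b = b'.
  by apply: functional_extensionality_dep => i; case: _ _ _ / (Eq i).
case: _ / Eb in q' Eq *.
suff -> : q = q' by [].
by apply: functional_extensionality_dep => i; apply: op_eqP.
Qed.

Lemma act_inv m n (f : 'I_m -> 'I_n) (hf : bijective f) (c : 'I_n -> col P)
    (b : 'I_m -> col P) d (e : forall i, b i = c (f i)) (g : 'I_n -> 'I_m)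
    (hg : bijective g) (e' : forall i, c i = b (g i)) (p : op c d) :
  cancel g f -> act hg e' (act hf e p) = p.
Proof.
by move=> fg; rewrite act_comp -[RHS]act_id; apply: act_eq.
Qed.

End Operads.

Lemma op_eq_hop (P Q : operad) (f g : operad_hom P Q) n (c : 'I_n -> col P) d
    (p : op c d) : f = g -> op_eq (hop f p) (hop g p).
Proof. by move=> ->. Qed.

Lemma operad_hom_ext (P Q : operad) (f g : operad_hom P Q) :
  hcol f =1 hcol g ->
  (forall n (c : 'I_n -> col P) d (p : op c d), op_eq (hop f p) (hop g p)) ->
  f = g.
Proof.
case: f g => [h o u a k] [h' o' u' a' k'] /= /functional_extensionality E.
case: _ / E in o' u' a' k' * => Eo.
suff E : o = o' by case: _ / E in u' a' k' *; apply: operad_hom_eq.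
do 4 apply: functional_extensionality_dep => ?.
exact/op_eqP.
Qed.

Lemma tree_map_eq (S T : tree) (f g : tree_map S T) : hcol f =1 hcol g -> f = g.
Proof.
move=> E; apply: operad_hom_ext => // n c d p.
have {}E : hcol f = hcol g by apply: functional_extensionality.
case: f g E => [h o u a k] [h' o' u' a' k'] /= E.
case: _ / E in o' u' a' k' *.
by rewrite (tree_op_irr (o _ _ _ p) (o' _ _ _ p)).
Qed.

(** * Branches of subtrees, and generation of operations by vertices *)

Section Trees.

Variable T : tree.
Implicit Types (a x y r : edge T) (u v : vertex T) (U W : {set vertex T}).

Definition enumerates n (c : 'I_n -> edge T) (v : vertex T) : Prop :=
  injective c /\ inputs v = [set c i | i : 'I_n].

Lemma enumeratesP n (c : 'I_n -> edge T) v x : enumerates c v ->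
  below x = Some v <-> exists i, c i = x.
Proof.
case=> _ /setP /(_ x); rewrite !inE => E.
split=> [/eqP|[i ci]].
  by rewrite E => /imsetP[i _ ->]; exists i.
by apply/eqP; rewrite E -ci imset_f.
Qed.

Lemma enumerates_below n (c : 'I_n -> edge T) v i :
  enumerates c v -> below (c i) = Some v.
Proof. by move=> /enumeratesP ->; exists i. Qed.

Lemma enumerates_act m n (f : 'I_m -> 'I_n) (c : 'I_n -> edge T) c' v :
  bijective f -> (forall i, c' i = c (f i)) ->
  enumerates c v -> enumerates c' v.
Proof.
move=> [g fg gf] E H; split=> [i j|].
  by rewrite !E => /H.1 /(can_inj fg).
apply/setP => x; rewrite H.2.
apply/imsetP/imsetP => -[i _ ->].
  by exists (g i); rewrite // E gf.
by exists (f i).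
Qed.

Lemma inputs_enum (v : vertex T) :
  exists n (c : 'I_n -> edge T), enumerates c v.
Proof.
exists #|inputs v|, (@enum_val _ (mem (inputs v))); split; first exact: enum_val_inj.
apply/setP => x; apply/idP/imsetP => [xv|[i _ ->]]; last exact: enum_valP.
by exists (enum_rank_in xv x); rewrite ?enum_rankK_in.
Qed.

(** Otherwise [x] and [out v] lie under each other and coincide; then [x] is fixed by [down], so it
    is the root, which is not an input. *)
Lemma not_under_input x v : below x = Some v -> ~ under x (out v).
Proof.
move=> B U; have E : x = out v.
  by apply: under_antisym => //; exists 1; rewrite /= (below_down B).
have : down x = x by rewrite (below_down B).
by move/down_fix => /below_root; rewrite B.
Qed.

(** The branches over different inputs of a vertex are disjoint: two inputs under a common edge are
    comparable, and if they differed, one would lie under the output of [v]. *)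
Lemma input_unique a a' x v :
  below a = Some v -> below a' = Some v -> under a x -> under a' x -> a = a'.
Proof.
suff H b b' : below b = Some v -> below b' = Some v -> under b b' -> b = b'.
  move=> B B' U U'; have [/H|/H E] := under_total U U'; first exact.
  by rewrite E.
move=> B B' [[|k]]; first by [].
rewrite iterSr (below_down B') => E.
by case: (not_under_input B); exists k.
Qed.

Lemma under_output_input v x :
  under (out v) x -> x = out v \/ exists2 a, below a = Some v & under a x.
Proof.
case=> k; elim: k => [|k IH] /=; first by left.
set y := iter k _ x; rewrite /down /step.
case B: (below y) => [u|] E; last exact: IH.
by right; exists y; [rewrite B (out_inj E) | exists k].
Qed.

Lemma underP x y : reflect (under x y) (fconnect (@down T) y x).
Proof.
apply: (iffP idP) => [C|[k <-]]; last exact: fconnect_iter.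
by exists (findex (@down T) y x); apply: iter_findex.
Qed.

Lemma corolla_sub_edges v : sub_edges [set v] (out v) = out v |: inputs v.
Proof. by rewrite /sub_edges big_set1. Qed.

Lemma corolla_subtree n (c : 'I_n -> edge T) v : enumerates c v ->
  is_subtree [set v] (out v) /\
  sub_leaves [set v] (out v) = [set c i | i : 'I_n].
Proof.
move=> H; rewrite /is_subtree /sub_leaves corolla_sub_edges -H.2.
have -> : outputs [set v] = [set out v] by rewrite /outputs imset_set1.
split; first exact: subsetUl.
apply/setP => x; rewrite !inE; case: eqVneq => //= ->.
apply/esym/eqP => B; case: (not_under_input B); exact: under_refl.
Qed.

Lemma tree_op_corolla n (c : 'I_n -> edge T) v :
  enumerates c v -> tree_op c (out v).
Proof.
by move=> H; split; [exact: H.1 | exists [set v]; apply: corolla_subtree].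
Qed.

Lemma tree_op_under n (c : 'I_n -> edge T) r i : tree_op c r -> under r (c i).
Proof.
case=> _ [W [sW lW]]; apply: (edge_under sW).
by have /setDP[] : c i \in sub_leaves W r by rewrite lW imset_f.
Qed.

Lemma subtree_root W r : is_subtree W r -> W != set0 ->
  exists2 v, v \in W & out v = r.
Proof.
move=> sW /set0Pn[v vW].
have [->|/imsetP[u]] := under_output sW (subsetP sW _ (imset_f _ vW))
  (under_refl r) (out_under sW vW); first by exists v.
by exists u.
Qed.

(** Cuts a subtree at its root vertex [v] into branches, one over each input. Walking down from an
    edge of the subtree over [a] stays in [W] until [a] is reached. *)
Lemma subtree_above W v a U :
  is_subtree W (out v) -> v \in W -> below a = Some v ->
  U = [set u in W | fconnect (@down T) (out u) a] ->
  is_subtree U a /\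
  sub_leaves U a = [set x in sub_leaves W (out v) | fconnect (@down T) x a].
Proof.
move=> sW vW B EU.
have UP u : u \in U <-> u \in W /\ under a (out u).
  by rewrite EU inE; split=> [/andP[? /underP]|[-> /underP]].
have edges x : x \in sub_edges U a <-> x \in sub_edges W (out v) /\ under a x.
  split.
    case/sub_edgesP => [->|[u /UP[uW au] Bx]].
      split; last exact: under_refl.
      by apply/sub_edgesP; right; exists v.
    split; first by apply/sub_edgesP; right; exists u.
    by apply: under_trans au _; exists 1; rewrite /= (below_down Bx).
  case=> xW ax; apply/sub_edgesP; case: ax => [[|k] E]; first by left.
  case/sub_edgesP: xW => [xv|[u uW Bx]].
    by case: (not_under_input B); exists k.+1; rewrite -xv.
  right; exists u => //; apply/UP; split=> //; exists k.
  by rewrite -(below_down Bx) -iterSr.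
have outs x : x \in outputs U <-> x \in outputs W /\ under a x.
  split=> [/imsetP[u /UP[uW au] ->]|[/imsetP[u uW ->] au]].
    by split=> //; apply: imset_f.
  by apply: imset_f; apply/UP.
split.
  apply/subsetP=> x /outs[xW ax]; apply/edges; split=> //; exact: (subsetP sW).
apply/setP=> x; rewrite [RHS]inE; apply/sub_leavesP/andP.
  case=> /edges[xW ax] no; split; last exact/underP.
  by apply/sub_leavesP; split=> //; apply/negP => xo; case/negP: no; apply/outs.
case=> /sub_leavesP[xW no] /underP ax; split; first exact/edges.
by apply/negP => /outs[xo _]; case/negP: no.
Qed.

(* Omega(T) is generated by the vertices of T. *)
Lemma tree_op_ind (Q : forall n, ('I_n -> edge T) -> edge T -> Prop) :
  (forall e, Q 1 (fun=> e) e) ->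
  (forall m n (f : 'I_m -> 'I_n) (c : 'I_n -> edge T) c' r, bijective f ->
     (forall i, c' i = c (f i)) -> tree_op c r -> Q n c r -> Q m c' r) ->
  (forall v n (c : 'I_n -> edge T) (k : 'I_n -> nat)
     (b : forall i, 'I_(k i) -> edge T), enumerates c v ->
     (forall i, tree_op (b i) (c i)) -> (forall i, Q (k i) (b i) (c i)) ->
     Q _ (concat b) (out v)) ->
  forall n (c : 'I_n -> edge T) r, tree_op c r -> Q n c r.
Proof.
move=> Q1 Qact Qnode n c r [ci [W [sW lW]]].
(* Induction on the number of vertices of the subtree. *)
have [m] := ubnP #|W|; elim: m n c r ci W sW lW => // m IH n c r ci W sW lW.
rewrite ltnS => Wm; have [W0|Wn0] := eqVneq W set0.
  have lr : sub_leaves W r = [set r].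
    by rewrite /sub_leaves /sub_edges /outputs W0 big_set0 imset0 setU0 setD0.
  have cr i : c i = r.
    by apply/set1P; rewrite -lr lW imset_f.
  have [i _ _] : exists2 i, i \in 'I_n & r = c i.
    by apply/imsetP; rewrite -lW lr set11.
  apply: (Qact _ _ (fun=> ord0) (fun=> r)) => //.
  - apply: bij_inj_card => [j j' _|j]; first by apply: ci; rewrite !cr.
    by exists i; rewrite (ord1 j).
  - exact: tree_op_unit.
have [v vW vr] := subtree_root sW Wn0; subst r.
have [p [d dv]] := inputs_enum v.
(* The branches over the inputs of the root vertex; they all omit [v], so the induction hypothesis
   applies to them. *)
pose U i := [set u in W | fconnect (@down T) (out u) (d i)].
have dB i : below (d i) = Some v := enumerates_below i dv.
have sU i : is_subtree (U i) (d i) by have [] := subtree_above sW vW (dB i) erefl.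
have lU i : sub_leaves (U i) (d i) =
    [set x in sub_leaves W (out v) | fconnect (@down T) x (d i)].
  by have [] := subtree_above sW vW (dB i) erefl.
have Um i : #|U i| < m.
  apply: leq_trans Wm; apply/proper_card/properP; split.
    by apply/subsetP=> u; rewrite inE => /andP[].
  exists v => //; rewrite inE vW /=; apply/underP/not_under_input; exact: dB.
pose k i := #|sub_leaves (U i) (d i)|.
pose b i : 'I_(k i) -> edge T := @enum_val _ (mem (sub_leaves (U i) (d i))).
have bi i : injective (b i) by apply: enum_val_inj.
have bim i : sub_leaves (U i) (d i) = [set b i j | j : 'I_(k i)].
  apply/setP => x; apply/idP/imsetP => [xv|[j _ ->]]; last exact: enum_valP.
  by exists (enum_rank_in xv x); rewrite /b ?enum_rankK_in.
have tb i : tree_op (b i) (d i).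
  by split=> //; exists (U i).
have [bc _] := tree_op_comp (tree_op_corolla dv) tb.
have lb i j : b i j \in sub_leaves W (out v).
  have : b i j \in sub_leaves (U i) (d i) by rewrite bim imset_f.
  by rewrite lU inE => /andP[].
(* Every leaf lies over some input of [v], so [c] lists the leaves of the branches up to a
   permutation. *)
have [f [fb Ef]] : exists f, bijective f /\ forall j, c j = concat b (f j).
  apply: same_image_bij => // [j|x].
    have cl : c j \in sub_leaves W (out v) by rewrite lW imset_f.
    have /sub_leavesP[cW no] := cl.
    have [E|[a Ba ac]] := under_output_input (edge_under sW cW).
      by rewrite E imset_f in no.
    have [i ia] := (enumeratesP a dv).1 Ba.
    have : c j \in sub_leaves (U i) (d i).
      by rewrite lU inE cl; apply/underP; rewrite ia.
    by rewrite bim => /imsetP[l _ ->]; exists (tagnat.Rank i l); rewrite concat_Rank.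
  have := lb (tagnat.sig1 x) (tagnat.sig2 x); rewrite lW => /imsetP[j _ E].
  by exists j.
apply: (Qact _ _ f (concat b)) => //.
  exact: tree_op_comp (tree_op_corolla dv) tb.
by apply: (Qnode v p d) => // i; apply: (IH _ _ _ _ (U i)).
Qed.

End Trees.

(** * Freeness of the operad of a tree on its vertices *)

Section FreeExtension.

Variables (P : operad) (T : tree) (h : edge T -> col P).
(** The values on generators form a relation that is functional, total and equivariant under
    reordering of inputs, so no order of the inputs of a vertex has to be chosen. *)
Variable Gen : forall (v : vertex T) n (c : 'I_n -> edge T),
  op (fun i => h (c i)) (h (out v)) -> Prop.

Hypothesis gen_enumerates : forall v n (c : 'I_n -> edge T) g,
  @Gen v n c g -> enumerates c v.
Hypothesis gen_fun : forall v n (c : 'I_n -> edge T) g g',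
  @Gen v n c g -> @Gen v n c g' -> g = g'.
Hypothesis gen_act : forall v m n (f : 'I_m -> 'I_n) (hf : bijective f)
  (c : 'I_n -> edge T) (c' : 'I_m -> edge T) (ec : forall i, c' i = c (f i)) g,
  @Gen v n c g -> @Gen v m c' (act hf (fun i => congr1 h (ec i)) g).
Hypothesis gen_total : forall v n (c : 'I_n -> edge T),
  enumerates c v -> exists g, @Gen v n c g.

(* [Val p] says that p is the value of the free extension at an operation of
   Omega(T).  Permutations are built into both constructors, so that a
   derivation is a normal form. *)
Inductive Val : forall n (c : 'I_n -> edge T) r,
    op (fun i => h (c i)) (h r) -> Prop :=
  | ValUnit n (f : 'I_n -> 'I_1) (hf : bijective f) (c : 'I_n -> edge T) r
      (ec : forall i, c i = r) :
      @Val n c r (act hf (fun i => congr1 h (ec i)) (unit_op (h r)))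
  | ValNode v n (d : 'I_n -> edge T) g (k : 'I_n -> nat)
      (b : forall i, 'I_(k i) -> edge T)
      (q : forall i, op (fun j => h (b i j)) (h (d i)))
      m (f : 'I_m -> 'I_(\sum_i k i)) (hf : bijective f) (c : 'I_m -> edge T)
      (ec : forall i, c i = concat b (f i)) :
      @Gen v n d g -> (forall i, Val (q i)) ->
      @Val m c (out v) (act hf (fun i => congr1 h (ec i)) (comp g q)).

(** The proof [eh] is independent of [ec], so that the lemma applies to whatever equality of colours
    an operad law produces. *)
Lemma Val_act m n (f : 'I_m -> 'I_n) (hf : bijective f) (c : 'I_n -> edge T)
    (c' : 'I_m -> edge T) r (ec : forall i, c' i = c (f i))
    (eh : forall i, h (c' i) = h (c (f i))) (p : op (fun i => h (c i)) (h r)) :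
  Val p -> @Val m c' r (act hf eh p).
Proof.
move=> V; case: V f hf c' ec eh => {n c r p}.
  move=> n f0 hf0 c r ec0 f hf c' ec eh; rewrite act_comp.
  have ec' i : c' i = r by rewrite ec ec0.
  rewrite (act_eq _ (bij_comp hf0 hf) _ (fun i => congr1 h (ec' i))) //.
  exact: ValUnit.
move=> v n d g k b q m0 f0 hf0 c ec0 G V f hf c' ec eh; rewrite act_comp.
have ec' i : c' i = concat b (f0 (f i)) by rewrite ec ec0.
rewrite (act_eq _ (bij_comp hf0 hf) _ (fun i => congr1 h (ec' i))) //.
exact: ValNode.
Qed.

Lemma Val_act_inv m n (f : 'I_m -> 'I_n) (hf : bijective f)
    (c : 'I_n -> edge T) (c' : 'I_m -> edge T) r
    (ec : forall i, c' i = c (f i)) (eh : forall i, h (c' i) = h (c (f i)))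
    (p : op (fun i => h (c i)) (h r)) :
  @Val m c' r (act hf eh p) -> Val p.
Proof.
have [g fg gf] := hf; have hg : bijective g by exists f.
have ec' i : c i = c' (g i) by rewrite ec gf.
move/(Val_act hg ec' (fun i => congr1 h (ec' i))).
by rewrite act_inv.
Qed.

Lemma Val_unit e : @Val 1 (fun=> e) e (unit_op (h e)).
Proof.
have V : @Val 1 (fun=> e) e _ := ValUnit (id_bij _) (fun=> erefl).
by move: V; rewrite act_id.
Qed.

Lemma Val_tree_op n (c : 'I_n -> edge T) r (p : op (fun i => h (c i)) (h r)) :
  Val p -> tree_op c r.
Proof.
elim=> {n c r p} [n f hf c r ec|v n d g k b q m f hf c ec G _ IH].
  exact: tree_op_act hf ec (tree_op_unit r).
apply: tree_op_act hf ec (tree_op_comp _ IH).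
exact: tree_op_corolla (gen_enumerates G).
Qed.

Lemma Val_node v n (d : 'I_n -> edge T) g (k : 'I_n -> nat)
    (b : forall i, 'I_(k i) -> edge T)
    (q : forall i, op (fun j => h (b i j)) (h (d i))) :
  Gen g -> (forall i, Val (q i)) -> @Val _ (concat b) (out v) (comp g q).
Proof.
move=> G V; have E i : concat b i = concat b i by [].
by have := ValNode (id_bij _) E G V; apply: Val_act_inv.
Qed.

Lemma Val_gen v n (c : 'I_n -> edge T) g : @Gen v n c g -> Val g.
Proof.
move=> G; have := Val_node G (fun i => Val_unit (c i)).
by rewrite comp_unit_r; apply: Val_act_inv.
Qed.

(** What can be grafted onto the leaf [x]: a value with output [x], packed with its arity and
    inputs. *)
Definition decoration (x : edge T) : Type :=
  {k : nat & {b : 'I_k -> edge T & {q : op (fun j => h (b j)) (h x) | Val q}}}.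

Definition dec_b x (t : decoration x) : 'I_(tag t) -> edge T := tag (tagged t).
Arguments dec_b [x] t _.
Definition dec_q x (t : decoration x) : op (fun j => h (dec_b t j)) (h x) :=
  proj1_sig (tagged (tagged t)).
Definition dec_V x (t : decoration x) : Val (dec_q t) :=
  proj2_sig (tagged (tagged t)).

(* The quantification over families of [decoration] allows reindexing them by
   [bij_reindex]. *)
Let closed n (c : 'I_n -> edge T) r (p : op (fun i => h (c i)) (h r)) : Prop :=
  forall t : forall i, decoration (c i),
    @Val _ (concat (fun i => dec_b (t i))) r (comp p (fun i => dec_q (t i))).

Let closed_act m n (f : 'I_m -> 'I_n) (hf : bijective f)
    (c : 'I_n -> edge T) (c' : 'I_m -> edge T) r
    (ec : forall i, c' i = c (f i)) (eh : forall i, h (c' i) = h (c (f i)))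
    (p : op (fun i => h (c i)) (h r)) :
  closed p -> @closed m c' r (act hf eh p).
Proof.
have E : c' = fun i => c (f i) by apply: functional_extensionality.
case: _ / (esym E) in ec eh * => {c' E ec} Cp t.
have [t' ->] := @bij_reindex _ _ (fun j => decoration (c j)) f t hf.
rewrite (act_eq hf hf eh (fun=> erefl)) // (comp_act_l hf p (fun j => dec_q (t' j))).
exact: (Val_act _ (block_map_concat (s := f) (b' := fun j => dec_b (t' j))
  (fun _ _ => erefl))).
Qed.

(** Induction on the derivation of [p]: the unit law settles the base case, and associativity moves
    the grafted operations into the branches of a node. *)
Lemma Val_comp n (c : 'I_n -> edge T) r (k : 'I_n -> nat)
    (b : forall i, 'I_(k i) -> edge T) (p : op (fun i => h (c i)) (h r))
    (q : forall i, op (fun j => h (b i j)) (h (c i))) :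
  Val p -> (forall i, Val (q i)) -> @Val _ (concat b) r (comp p q).
Proof.
suff H : Val p -> closed p.
  move=> /H Cp V.
  exact: (Cp (fun i => existT _ (k i) (existT _ (b i) (exist _ (q i) (V i))))).
move=> V; elim: V => {n c r k b p q}.
  move=> n f hf c r ec; apply: (closed_act hf (c := fun=> r)) => // t.
  have -> : t = fun=> t ord0.
    by apply: functional_extensionality_dep => i; rewrite (ord1 i).
  rewrite (comp_unit_l (dec_q (t ord0))).
  exact: Val_act (dec_V _).
move=> v n d g k b q m f hf c ec G _ IH; apply: (closed_act hf ec) => t.
pose B (x : {i & 'I_(k i)}) := decoration (b (tag x) (tagged x)).
(* Positions in the concatenation correspond to pairs of a block and an entry, which gives the
   doubly indexed family that [comp_assoc] needs. *)
pose F (x : 'I_(\sum_i k i)) : {i & 'I_(k i)} := Tagged _ (tagnat.sig2 x).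
have Fb : bijective F.
  have FE x : tagnat.sig x = F x by rewrite tagnat.sigE12.
  exists (@tagnat.rank n k) => x; first by rewrite -FE tagnat.sigK.
  by rewrite -FE tagnat.rankK.
have [t' ->] := @bij_reindex _ _ B F t Fb.
pose s i (j : 'I_(k i)) : decoration (b i j) := t' (Tagged _ j).
rewrite (comp_assoc g q (fun i j => dec_q (s i j))).
apply: (Val_act _ (assoc_map_concat (fun i j => dec_b (s i j)))).
by apply: Val_node => // i; exact: IH.
Qed.

(** Keeps the two constructors of [Val] apart: the single edge [r] of a unit would be both the
    output of [v] and an edge over an input of [v]. *)
Let shape_unit n (f : 'I_n -> 'I_1) (c : 'I_n -> edge T) r v m (d : 'I_m -> edge T)
    (k : 'I_m -> nat) (b : forall i, 'I_(k i) -> edge T) (f' : 'I_n -> 'I_(\sum_i k i)) :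
  bijective f -> (forall i, c i = r) -> out v = r -> enumerates d v ->
  (forall i, tree_op (b i) (d i)) -> ~ (forall i, c i = concat b (f' i)).
Proof.
move=> [g _ _] cr vr dv tb E; pose i := g ord0; pose x := f' i.
have := tree_op_under (tagnat.sig2 x) (tb (tagnat.sig1 x)).
rewrite -[b _ _]/(concat b x) -E cr -vr; apply: not_under_input.
exact: enumerates_below.
Qed.

(** Uniqueness is proved up to a permutation [f], because two derivations may list the inputs of a
    vertex, and the leaves of each branch, in different orders. *)
Lemma Val_unique_act n (c : 'I_n -> edge T) r (p : op (fun i => h (c i)) (h r))
    m (c' : 'I_m -> edge T) r' (p' : op (fun i => h (c' i)) (h r'))
    (f : 'I_m -> 'I_n) (hf : bijective f) (ec : forall i, c' i = c (f i)) :
  Val p -> Val p' -> r = r' ->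
  op_eq p' (act hf (fun i => congr1 h (ec i)) p).
Proof.
move=> V; elim: V m c' r' p' f hf ec => {n c r p}.
  move=> n f hf c r ec m c' r' p' f' hf' ec' V.
  case: V f' hf' ec' => {m c' r' p'}.
    move=> m f0 hf0 c' r' ec0 f' hf' ec' rr; case: _ / rr in c' ec0 ec' *.
    by rewrite act_comp; apply: op_eq_act => // i; rewrite [LHS]ord1 [RHS]ord1.
  move=> v m d g k b q m' f0 hf0 c' ec0 G V f' hf' ec' rr; exfalso.
  have E i : c' i = r by rewrite ec' ec.
  apply: (shape_unit (bij_comp hf hf') E (esym rr) (gen_enumerates G) _ ec0).
  by move=> i; apply: Val_tree_op (V i).
move=> v n d g k b q m f hf c ec G V IH m' c' r' p' f' hf' ec' V'.
have dv := gen_enumerates G.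
have tb i : tree_op (b i) (d i) by apply: Val_tree_op (V i).
case: V' f' hf' ec' => {m' c' r' p'}.
  move=> m' f0 hf0 c' r' ec0 f' hf' ec' rr; exfalso.
  have E i : c' i = concat b (f (f' i)) by rewrite ec' ec.
  exact: (shape_unit hf0 ec0 rr dv tb E).
move=> v' n' d' g' k' b' q' m' f0 hf0 c' ec0 G' V' f' hf' ec' /out_inj vv.
case: _ / vv in d' g' q' G' V' *.
have dv' := gen_enumerates G'.
have tb' i : tree_op (b' i) (d' i) by apply: Val_tree_op (V' i).
(* [s] matches the two orders of the inputs of the common root vertex. *)
have [s [hs Es]] : exists s : 'I_n' -> 'I_n, bijective s /\ forall j, d' j = d (s j).
  apply: same_image_bij => [||j|i]; [exact: dv.1|exact: dv'.1| |].
    have [i <-] := (enumeratesP (d' j) dv).1 (enumerates_below j dv').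
    by exists i.
  have [j <-] := (enumeratesP (d i) dv').1 (enumerates_below i dv).
  by exists j.
have bc : injective (concat b).
  by have [] := tree_op_comp (tree_op_corolla dv) tb.
have under_b i j : under (d i) (b i j) := tree_op_under j (tb i).
have under_b' i j : under (d' i) (b' i j) := tree_op_under j (tb' i).
(* A leaf lies over only one input of [v], so the permutation of all leaves carries block [i] onto
   block [s i]. *)
have block i : exists z : 'I_(k' i) -> 'I_(k (s i)),
    bijective z /\ forall j, b' i j = b (s i) (z j).
  apply: same_image_bij => [||j|j]; [exact: (tb _).1|exact: (tb' _).1| |].
    have [l _ lf] := hf0; pose x := f (f' (l (tagnat.Rank i j))).
    have E : b' i j = b (tagnat.sig1 x) (tagnat.sig2 x).
      by rewrite -[RHS]/(concat b x) -ec -ec' ec0 lf concat_Rank.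
    have Ei : tagnat.sig1 x = s i.
      apply: dv.1; apply: (@input_unique _ _ _ (b' i j) v).
      - exact: enumerates_below.
      - exact: enumerates_below.
      - by rewrite E.
      - by rewrite -Es.
    by rewrite E; case: _ / Ei; exists (tagnat.sig2 x).
  have [l _ lf0] := bij_comp hf hf'; have lf y : f (f' (l y)) = y := lf0 y.
  pose x := f0 (l (tagnat.Rank (s i) j)).
  have E : b (s i) j = b' (tagnat.sig1 x) (tagnat.sig2 x).
    by rewrite -[RHS]/(concat b' x) -ec0 ec' ec lf concat_Rank.
  have Ei : tagnat.sig1 x = i.
    apply: dv'.1; apply: (@input_unique _ _ _ (b (s i) j) v).
    - exact: enumerates_below.
    - exact: enumerates_below.
    - by rewrite E.
    - by rewrite Es.
  by rewrite E; case: _ / Ei; exists (tagnat.sig2 x).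
have /functional_extensionality Ed := Es.
case: _ / (esym Ed) in q' g' G' V' IH tb' Es dv' under_b' block *.
have [z Hz] := fin_all_exists block.
have zb i : bijective (z i) := (Hz i).1.
have Ez i j : b' i j = b (s i) (z i j) := (Hz i).2 j.
have Eq' : q' = fun i => act (zb i) (fun j => congr1 h (Ez i j)) (q (s i)).
  apply: functional_extensionality_dep => i; apply: op_eqP.
  exact: IH (V' i) erefl.
have Eg' := gen_fun G' (gen_act hs (fun=> erefl) G).
(* Equivariance collects all permutations outside the composite. The two resulting permutations
   agree because [concat b] is injective. *)
rewrite Eg' Eq' comp_act_r (comp_act_l hs g q) !act_comp.
apply: op_eq_act => // i; apply: bc => /=.
rewrite -(block_map_concat (s := s) (fun _ _ => erefl)).
rewrite -(block_map_concat (s := id) (b' := fun i => b (s i)) (g := z) Ez).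
by rewrite -ec0 ec' ec.
Qed.

Lemma Val_unique n (c : 'I_n -> edge T) r (p p' : op (fun i => h (c i)) (h r)) :
  Val p -> Val p' -> p = p'.
Proof.
move=> V V'; have E i : c i = c i by [].
have := op_eqP (Val_unique_act (id_bij _) E V V' erefl).
by rewrite (act_eq _ (id_bij _) _ (fun=> erefl)) // act_id.
Qed.

Lemma Val_total n (c : 'I_n -> edge T) r :
  tree_op c r -> exists p : op (fun i => h (c i)) (h r), Val p.
Proof.
elim/(@tree_op_ind T) => {n c r} [e|m n f c c' r hf ec _ [p V]|v n c k b cv _ IH].
- by exists (unit_op (h e)); apply: Val_unit.
- by exists (act hf (fun i => congr1 h (ec i)) p); apply: Val_act V.
have [g G] := gen_total cv.
have [q V] := fin_all_exists IH.
by exists (comp g q); apply: Val_node.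
Qed.

(** Each operation is sent to its unique value. Every law of an operad map holds because both sides
    are values of the same operation. *)
Lemma free_extension : exists F : operad_hom (tree_operad T) P,
  exists E : hcol F = h, forall n (c : 'I_n -> edge T) r (t : tree_op c r)
    (p : op (fun i => h (c i)) (h r)), Val p -> op_eq (hop F t) p.
Proof.
pose o n (c : 'I_n -> edge T) r (t : tree_op c r) :=
  proj1_sig (constructive_indefinite_description _ (Val_total t)).
have oV n (c : 'I_n -> edge T) r (t : tree_op c r) : Val (o _ _ _ t).
  by rewrite /o; case: constructive_indefinite_description.
unshelve eexists (@OperadHom (tree_operad T) P h o _ _ _).
- by move=> c; apply: Val_unique (oV _ _ _ _) (Val_unit _).
- move=> m n f hf c c' d ec t; apply: Val_unique (oV _ _ _ _) _.
  exact: Val_act (oV _ _ _ _).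
- move=> n c d k b t q; apply: Val_unique (oV _ _ _ _) _.
  by apply: Val_comp => // i; apply: oV.
exists erefl => n c r t p V; rewrite -(Val_unique (oV _ _ _ t) V).
exact: op_eq_refl.
Qed.

End FreeExtension.

(** * Proper subtrees lie in outer faces *)

Section ProperSubtrees.

Variables (T : tree) (e : edge T).
Hypothesis he : inner e.
Implicit Types (a x y r : edge T) (u v w : vertex T) (W : {set vertex T}).

Lemma inner_vertices : exists u w, [/\ out u = e, below e = Some w & u != w].
Proof.
case/andP: (he); rewrite /is_input; case B: (below e) => [w|//] _ /codomP[u ue].
exists u, w; split=> //; apply: contra_notN (not_under_input B) => /eqP <-.
by rewrite -ue; apply: under_refl.
Qed.

Lemma one_vertex_proper v : [set v] != setT.
Proof.
have [u [w [_ _ uw]]] := inner_vertices; apply: contraNneq uw => /setP E.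
by have := E u; have := E w; rewrite !inE => /eqP -> /eqP ->.
Qed.

Lemma all_vertices_subtree : is_subtree setT (root T).
Proof.
apply/subsetP => _ /imsetP[v _ ->]; apply/sub_edgesP.
case B: (below (out v)) => [w|]; last by left; apply/below_root.
by right; exists w.
Qed.

Lemma root_vertex : exists w, out w = root T.
Proof.
have [u _] := inner_vertices.
have [|w _ wr] := subtree_root all_vertices_subtree; last by exists w.
by apply/set0Pn; exists u.
Qed.

Definition top v : bool := [forall a, (below a == Some v) ==> ~~ is_output a].

Lemma top_above v : exists2 t, top t & under (out v) (out t).
Proof.
(* The number of edges over [out v] drops when passing to a vertex on an input of [v]. *)
have [m] := ubnP #|[pred x | fconnect (@down T) x (out v)]|.
elim: m v => // m IH v; rewrite ltnS => vm.
have [vt|] := boolP (top v); first by exists v => //; apply: under_refl.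
case/forallPn => a; rewrite negb_imply negbK => /andP[/eqP B /codomP[u ua]].
have va : under (out v) a by exists 1; rewrite /= (below_down B).
have [t tt ut] : exists2 t, top t & under (out u) (out t).
  apply: IH; apply: leq_trans vm; apply/proper_card/properP; split.
    apply/subsetP => x; rewrite !inE -ua => /underP ax; apply/underP.
    exact: under_trans va ax.
  exists (out v); rewrite !inE; first exact/underP/under_refl.
  by rewrite -ua; apply/underP/not_under_input.
by exists t => //; apply: under_trans va _; rewrite ua.
Qed.

Lemma outer_vertexI v x : attached v x -> inner x ->
  (forall y, attached v y -> inner y -> y = x) -> outer_vertex v.
Proof.
move=> ax ix U; apply/eqP; rewrite -(card1 x); apply: eq_card => y.
rewrite !inE; apply/andP/eqP => [[]|->]; [exact: U|by []].
Qed.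

Lemma under_is_output x y : is_output y -> under x y -> is_output x.
Proof.
move=> yo [k <-]; elim: k => //= k IH; rewrite /down /step.
by case: (below _) => // u; apply: codom_f.
Qed.

(** If [out v] were the root, any other vertex would lie over an input of [v], making that input an
    output; and [T] has at least two vertices. *)
Lemma top_inner v : top v -> inner (out v).
Proof.
move=> vt; rewrite /inner /is_output codom_f andbT.
apply/eqP => /below_root vr.
have vmin w : under (out v) (out w) by rewrite vr; apply: to_root.
suff vu w : w = v by case: inner_vertices => u [w [_ _]]; rewrite (vu u) (vu w) eqxx.
apply: (@out_inj T); have [//|[a Ba aw]] := under_output_input (vmin w).
have := forallP vt a.
by rewrite Ba eqxx (under_is_output _ aw) // /is_output codom_f.
Qed.

Lemma top_outer v : top v -> outer_vertex v.
Proof.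
move=> vt; apply: outer_vertexI (top_inner vt) _; first by rewrite /attached eqxx.
move=> y /orP[/eqP //|B] /andP[_ yo].
by have := forallP vt y; rewrite B yo.
Qed.

(* If W contains every vertex that has no vertices above it, then the vertices
   outside W form a chain below the root of W, so the root vertex can be pruned. *)
Lemma nonempty_avoids_outer W r :
  is_subtree W r -> W != set0 -> W != setT ->
  exists v, [/\ outer_vertex v, v \notin W &
    forall x, x \in sub_edges W r -> attached v x -> inner x].
Proof.
move=> sW W0 WT; have [z zW zr] := subtree_root sW W0.
have ro : is_output r by rewrite -zr /is_output codom_f.
have [/existsP[v /andP[vt vW]]|/existsPn tW] :=
    boolP [exists v, top v && (v \notin W)].
  exists v; split=> //; first exact: top_outer.
  move=> x xW /orP[/eqP <-|/eqP B]; first exact: top_inner.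
  (* An input of [v] in the subtree must be [r], since [v] is not in [W]; and [r] is an output. *)
  rewrite /inner /is_input B /=.
  case/sub_edgesP: xW => [-> //|[u uW]]; rewrite B => -[vu].
  by rewrite vu uW in vW.
have topW t : top t -> t \in W by move=> tt; have := tW t; rewrite tt negbK.
have outW t : t \in W -> out t \in sub_edges W r.
  by move=> tW'; apply: (subsetP sW); apply: imset_f.
(* Every vertex has a top vertex over it, which is in [W]; with [r] the root, walking down from
   there would put all vertices in [W]. *)
have rn : r <> root T.
  move=> rr; case/negP: WT; apply/eqP/setP => v; rewrite inE.
  have [t tt vt] := top_above v; have tW' := topW t tt.
  have rv : under r (out v) by rewrite rr; apply: to_root.
  have [/(@out_inj T) -> //|] := under_output sW (outW t tW') rv vt.
  by case/imsetP => u uW /(@out_inj T) ->.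
have {}rn : ~ under r (root T).
  by move=> rr; apply: rn; apply: under_antisym rr (to_root r).
have [w wr] := root_vertex.
have wW : w \notin W by apply/negP => /(out_under sW); rewrite wr.
have rootE x : below x = Some w -> under r x -> x = r.
  by move=> B [[|k] //]; rewrite iterSr (below_down B) wr => E; case: rn; exists k.
(* A top vertex over [u] is in [W], hence over [r], so [out u] and [r] are comparable; both cases
   put [out u] under [r]. Thus at most one input of [w] is an output. *)
have above_r u : below (out u) = Some w -> under (out u) r.
  move=> B; have [t tt ut] := top_above u.
  have [rx|//] := under_total (out_under sW (topW t tt)) ut.
  by rewrite (rootE _ B rx); apply: under_refl.
exists w; split=> //.
  have : ~~ top w by apply: contra wW; apply: topW.
  case/forallPn => a; rewrite negb_imply negbK => /andP[/eqP B ao].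
  have ar : under a r by move: ao B => /codomP[u ->]; apply: above_r.
  apply: (@outer_vertexI w a); rewrite /attached /inner /is_input ?B ?eqxx ?orbT //.
  move=> y /orP[/eqP <-|/eqP By] /andP[yi yo].
    by case/eqP: yi; apply/below_root.
  have yr : under y r by move: yo By => /codomP[u ->]; apply: above_r.
  exact: input_unique By B yr ar.
(* Every edge of the subtree lies over [r]. This excludes the root, and the only input of [w] over
   [r] is [r] itself. *)
move=> x xW; have rx := edge_under sW xW.
case/orP=> /eqP B; first by case: rn; rewrite -wr B.
by rewrite (rootE _ B rx) // /inner ro -(rootE _ B rx) // /is_input B.
Qed.

(** For empty [W] the subtree is the edge [r], which is enlarged to a corolla having [r] among its
    edges; that corolla is still proper. *)
Lemma avoids_outer W r : is_subtree W r -> W != setT ->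
  exists v, [/\ outer_vertex v, v \notin W &
    forall x, x \in sub_edges W r -> attached v x -> inner x].
Proof.
move=> sW; have [W0 _|] := eqVneq W set0; last exact: nonempty_avoids_outer.
have [w rw] : exists w, r \in sub_edges [set w] (out w).
  case B: (below r) => [w|].
    by exists w; rewrite corolla_sub_edges !inE B eqxx orbT.
  have [w wr] := root_vertex; exists w.
  by rewrite corolla_sub_edges !inE wr; apply/orP; left; apply/eqP/below_root.
have sw : is_subtree [set w] (out w).
  by rewrite /is_subtree /outputs imset_set1 corolla_sub_edges subsetUl.
have w0 : [set w] != set0 by apply/set0Pn; exists w; rewrite inE.
have [v [vo _ ve]] := nonempty_avoids_outer sw w0 (one_vertex_proper w).
exists v; split=> // [|x]; first by rewrite W0 inE.
rewrite W0 /sub_edges big_set0 setU0 => /set1P ->; exact: ve.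
Qed.

(** An outer vertex avoided by the subtree can be pruned without losing any of its edges, so the
    operation already lives in that outer face. *)
Lemma proper_tree_op_prune n (c : 'I_n -> edge T) r W :
  injective c -> is_subtree W r -> sub_leaves W r = [set c i | i : 'I_n] ->
  W != setT ->
  exists v (hv : outer_vertex v) (c' : 'I_n -> edge (prune hv)) (r' : edge (prune hv)),
    [/\ tree_op c' r', forall i, c i = val (c' i) & r = val r'].
Proof.
move=> ci sW lW WT; have [v [hv vW ve]] := avoids_outer sW WT.
have re : attached v r ==> inner r.
  by apply/implyP; apply: ve; apply/sub_edgesP; left.
have ce i : attached v (c i) ==> inner (c i).
  apply/implyP; apply: ve; have : c i \in sub_leaves W r by rewrite lW imset_f.
  by case/sub_leavesP.
pose r' : edge (prune hv) := exist _ r re.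
pose c' i : edge (prune hv) := exist _ (c i) (ce i).
exists v, hv, c', r'; split=> //; split=> [i j /(congr1 val) /ci //|].
(* [W] read in the pruned tree; lifting it back gives [W], as [v] is not in [W]. *)
pose W' : {set vertex (prune hv)} := [set u | val u \in W].
have EW : prune_lift W' = W.
  apply/setP => u; apply/imsetP/idP => [[u' + ->]|uW]; first by rewrite inE.
  have uv : u != v by apply: contraNneq vW => <-.
  by exists (exist _ u uv); rewrite ?inE.
have edgesW := prune_sub_edges hv W' r'; have outW := prune_outputs hv W'.
rewrite EW in edgesW outW; exists W'; split.
  apply/subsetP => x xW; have : val x \in sub_edges W r.
    by apply: (subsetP sW); rewrite outW; apply: imset_f.
  by rewrite edgesW mem_imset //; apply: val_inj.
apply/setP => x.
have : (val x \in sub_leaves W r) = (val x \in [set c i | i : 'I_n]) by rewrite lW.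
rewrite /sub_leaves edgesW outW !in_setD !mem_imset; try exact: val_inj.
move=> ->; apply/imsetP/imsetP => -[i _ E]; exists i => //; last by rewrite E.
exact: val_inj.
Qed.

End ProperSubtrees.

(** * Corollas as classifiers of operations *)

Definition corolla (n : nat) : tree.
Proof.
refine (@Tree (option 'I_n) unit None (fun=> None)
  (fun a => if a is Some _ then Some tt else None) _ _ _).
- by case=> [] [].
- by case.
- by case=> [i|]; [exists 1 | exists 0].
Defined.

Lemma corolla_enumerates n : @enumerates (corolla n) n Some tt.
Proof.
split; first by move=> i j [].
apply/setP => -[i|]; rewrite inE /=; first by rewrite imset_f ?eqxx.
by apply/esym/negbTE/imsetP => -[].
Qed.

Lemma corolla_op n : @tree_op (corolla n) n Some None.
Proof. exact: tree_op_corolla (corolla_enumerates n). Qed.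

(** By [tree_op_ind] only the vertex of the corolla matters, and every listing of its inputs is a
    permutation of [Some]. The resulting map sends the generating operation of the corolla to
    [t]. *)
Lemma corolla_map_op (S : tree) n (c : 'I_n -> edge S) r : tree_op c r ->
  forall m (d : 'I_m -> edge (corolla n)) a, tree_op d a ->
  tree_op (fun i => if d i is Some j then c j else r)
          (if a is Some j then c j else r).
Proof.
move=> t m d a.
elim/(@tree_op_ind (corolla n)) => {m d a} [a|m p f d d' a hf ed _ IH|v m d k b dv _ IH].
- exact: tree_op_unit.
- by apply: (tree_op_act hf _ IH) => i; rewrite ed.
apply: (tree_op_comp _ IH).
have cv := corolla_enumerates n; case: v dv => dv.
have [f [hf Ef]] : exists f : 'I_m -> 'I_n, bijective f /\ forall j, d j = Some (f j).
  apply: same_image_bij => [||j|i]; [exact: cv.1|exact: dv.1| |].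
    have [i <-] := (enumeratesP (d j) cv).1 (enumerates_below j dv).
    by exists i.
  have [j <-] := (enumeratesP (Some i : edge (corolla n)) dv).1 (enumerates_below i cv).
  by exists j.
by apply: (tree_op_act hf _ t) => i; rewrite Ef.
Qed.

Definition corolla_map (S : tree) n (c : 'I_n -> edge S) r (t : tree_op c r) :
  tree_map (corolla n) S := tree_map_of (corolla_map_op t).

(** * Extending a map from the inner horn *)

Section HornExtension.

Variables (P : operad) (T : tree) (e : edge T) (he : inner e).

Lemma face_in_horn (f : face T) : f <> InnerFace he -> in_inner_horn he (face_map f).
Proof.
by move=> fe; exists f; split=> //; exists (operad_id _); rewrite operad_comp_id_r.
Qed.

Lemma outer_face_in_horn v (hv : @outer_vertex T v) : in_inner_horn he (outer_face hv).
Proof. exact: (@face_in_horn (OuterFace hv)). Qed.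

Lemma edge_prune (a : edge T) : exists v (hv : @outer_vertex T v) (a' : edge (prune hv)),
  a = val a'.
Proof.
have sW : is_subtree set0 a by rewrite /is_subtree /outputs imset0 sub0set.
have W0 : set0 != [set: vertex T].
  have [u _] := inner_vertices he; apply/eqP => /setP /(_ u).
  by rewrite !inE.
have [v [hv _ va]] := avoids_outer he sW W0.
have ae : attached v a ==> inner a.
  by apply/implyP; apply: va; apply/sub_edgesP; left.
by exists v, hv, (exist _ a ae).
Qed.

(** Since [T] has several vertices, an edge is not itself a face of [T]; it enters the horn through
    an outer face. *)
Lemma edge_face_in_horn (a : edge T) : in_inner_horn he (edge_face a).
Proof.
have [v [hv [a' ->]]] := edge_prune a.
exists (OuterFace hv); split=> //; exists (@edge_face (prune hv) a').
exact: tree_map_eq.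
Qed.

Lemma corolla_prune n (c : 'I_n -> edge T) (u : vertex T) :
  enumerates c u ->
  exists v (hv : outer_vertex v) (c' : 'I_n -> edge (prune hv)) (r' : edge (prune hv)),
    [/\ tree_op c' r', forall i, c i = val (c' i) & out u = val r'].
Proof.
move=> cu; have [sW lW] := corolla_subtree cu.
exact: (proper_tree_op_prune he cu.1 sW lW (one_vertex_proper he u)).
Qed.

(** Gives uniqueness of the extension: each edge and each corolla lies in an outer face, and
    corollas generate. *)
Lemma operad_hom_outer_ext (F G : operad_hom (tree_operad T) P) :
  (forall v (hv : @outer_vertex T v),
     operad_comp F (outer_face hv) = operad_comp G (outer_face hv)) -> F = G.
Proof.
move=> E.
have Ecol a : hcol F a = hcol G a.
  have [v [hv [a' ->]]] := edge_prune a.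
  exact: (congr1 (fun H : operad_hom (tree_operad (prune hv)) P => hcol H a') (E v hv)).
(* The goal depends on [t], so a copy drives the induction; [tree_op_irr] then replaces [t] by the
   unit, permuted or composite operation at hand. *)
apply: operad_hom_ext => // n c r t; have t0 : tree_op c r := t; move: n c r t0 t.
apply: (@tree_op_ind T) => [a|m n f c c' r hf ec t IH|v n c k b cv tb IH] t'.
- rewrite (tree_op_irr t' (unit_op (a : col (tree_operad T)))) !hop_unit.
  exact: op_eq_unit.
- rewrite (tree_op_irr t' (@act (tree_operad T) _ _ _ _ _ _ hf ec t)) !hop_act.
  exact: op_eq_act.
pose tc : op (o := tree_operad T) c (out v) := tree_op_corolla cv.
rewrite (tree_op_irr t' (@comp (tree_operad T) _ _ _ _ _ tc tb)).
rewrite !hop_comp; apply: op_eq_comp => //.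
have [v' [hv [c' [r' [t2 Ec Er]]]]] := corolla_prune cv.
have {Ec} Ec : c = fun i => hcol (outer_face hv) (c' i).
  exact: functional_extensionality.
have {}Er : out v = hcol (outer_face hv) r' by [].
move: tc; rewrite Ec Er => tc.
pose t3 : op (o := tree_operad (prune hv)) c' r' := t2.
rewrite (tree_op_irr tc (hop (outer_face hv) t3)).
exact: (op_eq_hop t3 (E v' hv)).
Qed.

Variable x : dmap (inner_horn he) (nerve P).

Definition horn_value (S : tree) (y : tree_map S T) (hy : in_inner_horn he y) :
  operad_hom (tree_operad S) P := dfun x (exist _ y hy).

Lemma horn_value_comp (R S : tree) (y : tree_map S T) (g : tree_map R S) hy hyg :
  @horn_value R (operad_comp y g) hyg = operad_comp (@horn_value S y hy) g.
Proof.
rewrite (proof_irrelevance _ hyg (in_inner_horn_restr g hy)).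
exact: (dfun_nat x g (exist _ y hy : cell (inner_horn he) S)).
Qed.

(** The value at an operation depends only on its image in [T], not on the cell of the horn
    containing it: restricting both cells along the classifying corollas yields one and the same
    cell. *)
Lemma horn_value_op_eq S S' (y : tree_map S T) (y' : tree_map S' T) hy hy'
    n (c : 'I_n -> edge S) r (t : tree_op c r) (c' : 'I_n -> edge S') r'
    (t' : tree_op c' r') :
  (forall i, hcol y (c i) = hcol y' (c' i)) -> hcol y r = hcol y' r' ->
  op_eq (hop (horn_value (y := y) hy) (t : op (o := tree_operad S) c r))
        (hop (horn_value (y := y') hy') (t' : op (o := tree_operad S') c' r')).
Proof.
move=> Ec Er.
have via_corolla U (z : tree_map U T) hz (d : 'I_n -> edge U) s (w : tree_op d s) :
    op_eq (hop (horn_value (y := z) hz) (w : op (o := tree_operad U) d s))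
      (hop (horn_value (in_inner_horn_restr (corolla_map w) hz))
         (corolla_op n : op (o := tree_operad (corolla n)) (@Some 'I_n) None)).
  rewrite (horn_value_comp hz).
  have Ew : w = hop (corolla_map w)
      (corolla_op n : op (o := tree_operad (corolla n)) (@Some 'I_n) None).
    exact: tree_op_irr.
  rewrite {1}Ew; exact: op_eq_refl.
apply: op_eq_trans (via_corolla _ _ hy _ _ t) _.
apply: op_eq_sym; apply: op_eq_trans (via_corolla _ _ hy' _ _ t') _.
have E : operad_comp y (corolla_map t) = operad_comp y' (corolla_map t').
  by apply: tree_map_eq => -[i|] /=.
move: (in_inner_horn_restr _ hy) (in_inner_horn_restr _ hy').
rewrite E => h1 h2; rewrite (proof_irrelevance _ h1 h2); exact: op_eq_refl.
Qed.

Definition horn_col (a : edge T) : col P :=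
  hcol (horn_value (edge_face_in_horn a)) tt.

Lemma horn_value_col S (y : tree_map S T) hy a :
  hcol (horn_value (y := y) hy) a = horn_col (hcol y a).
Proof.
have E : edge_face (hcol y a) = operad_comp y (edge_face a) by apply: tree_map_eq.
rewrite /horn_col; move: (edge_face_in_horn _); rewrite E => hy'.
by rewrite (horn_value_comp hy).
Qed.

Let h := horn_col.

(** Any cell of the horn containing the corolla may supply the value, so no face is chosen;
    [horn_value_op_eq] makes the relation functional. *)
Definition horn_gen (v : vertex T) n (c : 'I_n -> edge T)
    (g : op (fun i => h (c i)) (h (out v))) : Prop :=
  enumerates c v /\
  exists S (y : tree_map S T) (hy : in_inner_horn he y) (c' : 'I_n -> edge S) r'
    (t : op (o := tree_operad S) c' r'),
    [/\ forall i, c i = hcol y (c' i), out v = hcol y r' &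
        op_eq g (hop (horn_value hy) t)].

Lemma horn_gen_fun v n (c : 'I_n -> edge T) g g' :
  @horn_gen v n c g -> @horn_gen v n c g' -> g = g'.
Proof.
move=> [_ [S [y [hy [d [r [t [Ec Er Eg]]]]]]]].
move=> [_ [S' [y' [hy' [d' [r' [t' [Ec' Er' Eg']]]]]]]].
apply/op_eqP/(op_eq_trans Eg)/(op_eq_trans _ (op_eq_sym Eg')).
by apply: horn_value_op_eq => [i|]; rewrite -?Ec -?Er.
Qed.

Lemma horn_gen_act v m n (f : 'I_m -> 'I_n) (hf : bijective f)
    (c : 'I_n -> edge T) (c' : 'I_m -> edge T) (ec : forall i, c' i = c (f i)) g :
  @horn_gen v n c g -> @horn_gen v m c' (act hf (fun i => congr1 h (ec i)) g).
Proof.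
move=> [cv [S [y [hy [d [r [t [Ec Er Eg]]]]]]]]; split.
  exact: enumerates_act hf ec cv.
exists S, y, hy, (fun i => d (f i)), r, (act hf (fun=> erefl) t).
split=> // [i|]; first by rewrite ec Ec.
by rewrite hop_act; apply: op_eq_act.
Qed.

Lemma horn_gen_total v n (c : 'I_n -> edge T) :
  enumerates c v -> exists g, @horn_gen v n c g.
Proof.
move=> cv; have [u [hu [c' [r' [t Ec Er]]]]] := corolla_prune cv.
pose q := hop (horn_value (outer_face_in_horn hu))
  (t : op (o := tree_operad (prune hu)) c' r').
have [i||g Eg] := @op_recolour _ _ _ (fun i => h (c i)) _ (h (out v)) q.
- by rewrite horn_value_col Ec.
- by rewrite horn_value_col Er.
exists g; split=> //.
by exists (prune hu), (outer_face hu), (outer_face_in_horn hu), c', r', t.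
Qed.

Local Notation horn_Val := (Val horn_gen).

(** On a cell, agreement of the free extension with [x] need only be tested at vertices, as both
    respect units, permutations and composition. The colours agree only through [horn_value_col],
    hence [op_eq]. *)
Lemma horn_Val_vertices S (y : tree_map S T) (hy : in_inner_horn he y) :
  (forall v n (c : 'I_n -> edge S) (t : op (o := tree_operad S) c (out v)),
     enumerates c v -> exists p, @horn_Val n (fun i => hcol y (c i)) (hcol y (out v)) p
       /\ op_eq p (hop (horn_value hy) t)) ->
  forall n (c : 'I_n -> edge S) r (t : op (o := tree_operad S) c r),
    exists p, @horn_Val n (fun i => hcol y (c i)) (hcol y r) p
       /\ op_eq p (hop (horn_value hy) t).
Proof.
move=> Hv n c r t; have t0 : tree_op c r := t; move: n c r t0 t.
apply: (@tree_op_ind S) => [a|m n f c c' r hf ec t IH|v n c k b cv tb IH] t'.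
- exists (unit_op (h (hcol y a))); split; first exact: Val_unit.
  rewrite (tree_op_irr t' (unit_op (a : col (tree_operad S)))) hop_unit.
  by apply: op_eq_unit; rewrite horn_value_col.
- have [p [V E]] := IH t.
  have ey i : hcol y (c' i) = hcol y (c (f i)) by rewrite ec.
  exists (act hf (fun i => congr1 h (ey i)) p); split; first exact: Val_act V.
  rewrite (tree_op_irr t' (@act (tree_operad S) _ _ _ _ _ _ hf ec t)) hop_act.
  exact: op_eq_act.
pose tc : op (o := tree_operad S) c (out v) := tree_op_corolla cv.
have [p [V E]] := Hv v n c tc cv.
have [q Vq] := fin_all_exists (fun i => IH i (tb i)).
rewrite (tree_op_irr t' (@comp (tree_operad S) _ _ _ _ _ tc tb)) hop_comp.
exists (comp p q); split; last by apply: op_eq_comp => // i; apply: (Vq i).2.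
exact: (Val_comp V (fun i => (Vq i).1)).
Qed.

(** A vertex of the pruned tree is a vertex of [T] with the same inputs, so its value is a generator
    by definition. *)
Lemma horn_Val_outer v (hv : @outer_vertex T v) n (c : 'I_n -> edge (prune hv)) r
    (t : op (o := tree_operad (prune hv)) c r) :
  exists p, @horn_Val n (fun i => hcol (outer_face hv) (c i))
                     (hcol (outer_face hv) r) p
    /\ op_eq p (hop (horn_value (outer_face_in_horn hv)) t).
Proof.
move: n c r t; apply: horn_Val_vertices => u n c t cu.
pose q := hop (horn_value (outer_face_in_horn hv)) t.
have [i||g Eg] := @op_recolour _ _ _ (fun i => h (hcol (outer_face hv) (c i))) _
  (h (hcol (outer_face hv) (out u))) q.
- by rewrite horn_value_col.
- by rewrite horn_value_col.
exists g; split=> //; apply: Val_gen => //; split; last first.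
  by exists (prune hv), (outer_face hv), (outer_face_in_horn hv), c, (out u), t.
split; first by move=> i j /val_inj /cu.1.
have E (a : edge (prune hv)) : below a = Some u <-> below (val a) = Some (val u).
  exact: prune_belowE.
apply/setP => a; rewrite inE; apply/eqP/imsetP => [B|[i _ ->]]; last first.
  by apply/E; apply: enumerates_below.
(* An input of a surviving vertex survives: if it is attached to [v], it joins the two vertices and
   is inner. *)
have ha : attached v a ==> inner a.
  apply/implyP => /orP[/eqP va|].
    by rewrite /inner /is_input /is_output B -va codom_f.
  by rewrite B => /eqP[uv]; have := valP u; rewrite /= uv eqxx.
pose a' : edge (prune hv) := exist _ a ha.
have [i Ei] := (enumeratesP a' cu).1 ((E a').2 B).
by exists i; rewrite ?Ei.
Qed.

(** The operation also occurs in an outer face, where agreement is known, and [horn_value_op_eq]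
    carries it back. *)
Lemma horn_Val_proper S (y : tree_map S T) (hy : in_inner_horn he y)
    n (c : 'I_n -> edge S) r (t : op (o := tree_operad S) c r) W :
  injective (fun i => hcol y (c i)) ->
  is_subtree W (hcol y r) -> sub_leaves W (hcol y r) = [set hcol y (c i) | i : 'I_n] ->
  W != setT ->
  exists p, @horn_Val n (fun i => hcol y (c i)) (hcol y r) p
    /\ op_eq p (hop (horn_value hy) t).
Proof.
move=> ci sW lW WT.
have [v [hv [c' [r' [t' Ec Er]]]]] := proper_tree_op_prune he ci sW lW WT.
have [p' [V E]] := horn_Val_outer (t' : op (o := tree_operad (prune hv)) c' r').
have {}E : op_eq p' (hop (horn_value hy) t).
  by apply: op_eq_trans E _; apply: horn_value_op_eq => [i|]; rewrite ?Ec ?Er.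
have Ec' : (fun i => hcol y (c i)) = (fun i => val (c' i)).
  exact: functional_extensionality.
(* [M] abstracts the inputs and the output, so that they can be rewritten although the type of [p]
   depends on them. *)
pose M d s := exists p, @horn_Val n d s p /\ op_eq p (hop (horn_value hy) t).
by rewrite -/(M (fun i => hcol y (c i)) (hcol y r)) Ec' Er; exists p'.
Qed.

(** The lift of [w] has at most [val w] and the vertex over [f]. If these were all vertices, the
    vertex over [e] would be [val w] as [f] is not [e], and the vertex below [e] would sit over [f],
    hence over [e]. *)
Lemma merged_vertices_proper (f : edge T) (hf : inner f) (w : vertex (contract hf)) :
  f <> e -> contract_lift [set w] != setT.
Proof.
move=> fe; have [u [w' [ue we uw]]] := inner_vertices he.
apply/eqP => /setP E.
have vE z : z = val w \/ (out z = f /\ below f = Some (val w)).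
  have := E z; rewrite [RHS]inE.
  case/contract_liftP => [[a /set1P -> ->]|[zf [a /set1P ->]]]; first by left.
  by right.
have uw1 : u = val w by case: (vE u) => // -[uf]; rewrite -uf ue in fe.
have [w1|[wf Bf]] := vE w'; first by rewrite uw1 w1 eqxx in uw.
case: (not_under_input we); rewrite wf -ue uw1.
by exists 1; rewrite /= (below_down Bf).
Qed.

Lemma horn_Val_face (f : face T) (fe : f <> InnerFace he) n
    (c : 'I_n -> edge (face_dom f)) r (t : op (o := tree_operad (face_dom f)) c r) :
  exists p, @horn_Val n (fun i => hcol (face_map f) (c i)) (hcol (face_map f) r) p
    /\ op_eq p (hop (horn_value (face_in_horn fe)) t).
Proof.
case: f fe c r t => [f hf|v hv|a T1] fe c r t.
- move: n c r t; apply: horn_Val_vertices => w n c t cw.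
  have ffe : f <> e.
    move=> E; apply: fe; case: _ / (esym E) in hf w c t cw *.
    by rewrite (bool_irrelevance hf he).
  have [sW lW] := corolla_subtree cw.
  have ci : injective (fun i => hcol (inner_face hf) (c i)).
    by move=> i j /val_inj /cw.1.
  have lW' : sub_leaves (contract_lift [set w]) (val (out w))
      = [set hcol (inner_face hf) (c i) | i : 'I_n].
    by rewrite (contract_leaves sW) lW -imset_comp.
  exact: (horn_Val_proper (face_in_horn fe) t ci (contract_subtree sW) lW'
    (merged_vertices_proper w ffe)).
- rewrite (proof_irrelevance _ (face_in_horn fe) (outer_face_in_horn hv)).
  exact: horn_Val_outer.
(* Edge faces exist only for trees with one vertex, while [T] has two. *)
have [u [w [_ _ /eqP]]] := inner_vertices he; case.
have [z zE] := fintype1 (eqP T1).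
by rewrite (zE u) (zE w).
Qed.

Lemma horn_extension : exists F : operad_hom (tree_operad T) P,
  forall S (y : tree_map S T) hy, operad_comp F y = horn_value (y := y) hy.
Proof.
have [F [Fh FV]] := free_extension (fun v n c g (G : @horn_gen v n c g) => G.1)
  horn_gen_fun horn_gen_act horn_gen_total.
exists F => S y hy; apply: operad_hom_ext => [a|n c r t].
  by rewrite horn_value_col /= Fh.
(* The cell factors through a face of the horn, and the operation is compared there. *)
have [f [fe [z Ey]]] := hy; subst y.
have [p [V E]] := horn_Val_face fe (hop z t).
have EF := FV _ _ _ (hop (face_map f) (hop z t)) p V.
apply: op_eq_trans EF (op_eq_trans E _).
exact: horn_value_op_eq.
Qed.

End HornExtension.

(** * Yoneda and the bijection *)

Lemma dmap_ext (X Y : dset) (f g : dmap X Y) :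
  (forall S (a : cell X S), dfun f a = dfun g a) -> f = g.
Proof.
case: f g => [f nf] [g ng] /= E.
have {}E : f = g.
  apply: functional_extensionality_dep => S.
  exact: functional_extensionality.
by case: _ / E in ng *; rewrite (proof_irrelevance _ nf ng).
Qed.

Definition yoneda (P : operad) (T : tree) (F : operad_hom (tree_operad T) P) :
  dmap (representable T) (nerve P).
Proof.
by exists (fun S (y : tree_map S T) => operad_comp F y) => S S' f y;
  apply: operad_comp_assoc.
Defined.

Lemma yoneda_surj (P : operad) (T : tree) (x : dmap (representable T) (nerve P)) :
  exists F, x = yoneda F.
Proof.
pose one : cell (representable T) T := operad_id (tree_operad T).
exists (dfun x one); apply: dmap_ext => S y.
rewrite -[RHS](dfun_nat x y one); congr (dfun x _).
exact/esym/operad_comp_id_l.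
Qed.

Theorem proposition5p3 (P : operad) : strict_inner_Kan (nerve P).
Proof.
move=> T e he.
pose ext (x : dmap (inner_horn he) (nerve P)) :=
  proj1_sig (constructive_indefinite_description _ (horn_extension x)).
have extE x S (y : tree_map S T) (hy : in_inner_horn he y) :
    operad_comp (ext x) y = horn_value x hy.
  by rewrite /ext; case: constructive_indefinite_description => F /= ->.
exists (fun x => yoneda (ext x)) => x; last first.
  by apply: dmap_ext => S [y hy]; apply: extE.
(* Extending the restriction of [F] gives back [F], because the two agree on outer faces. *)
have [F ->] := yoneda_surj x; congr yoneda.
apply: (operad_hom_outer_ext he) => v hv.
by rewrite (extE _ _ _ (outer_face_in_horn he hv)).
Qed.
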